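(* Assume the following. (A) There exist $\mathcal F'(\bar u)\in C^1(\omega_1)$ and a bounded bilinear form $\mathcal F''(\bar u)\colon C^1(\omega_1)^*\times C^1(\omega_1)^*\to\mathbb R$ such that $$\lim_{k\to\infty}\frac{\mathcal F(\bar u+t_kh_k)-\mathcal F(\bar u)-t_k\mathcal F'(\bar u)h_k-\tfrac12t_k^2\mathcal F''(\bar u)h_k^2}{t_k^2}=0$$ for all sequences $(t_k)\subset(0,\infty)$, $(h_k)\subset C^1(\omega_1)^*$ with $t_k\to0$, $h_k\stackrel{\star}{\rightharpoonup}h\in C^1(\omega_1)^*$ and $\bar u+t_kh_k\in\operatorname{dom}(\mathcal D)$. Additionally, the map $C^1(\omega_1)^*\ni h\mapsto\mathcal F''(\bar u)h^2$ is sequentially weak-$\star$ continuous. (B) The function $\bar\varphi:=-\frac2\alpha\mathcal F'(\bar u)$ is a Kantorovich potential for $\bar u$ and there exist a Borel-measurable map $\bar T\colon\omega_0\to\omega_1$, constants $\varepsilon_0,\gamma,C>0$ and a function $\delta\colon\omega_0\to[0,\infty)$ such that for all $x\in\omega_0$, with $\bar\eta:=\bar T(x)$, $$c(x,\eta)-\bar\varphi(\eta)\ge c(x,\bar\eta)-\bar\varphi(\bar\eta)+\tfrac\gamma2|\eta-\bar\eta|^2\quad\forall\eta\in\omega_1\cap B_{\varepsilon_0}(\bar\eta),$$ $$c(x,\eta)-\bar\varphi(\eta)\ge c(x,\bar\eta)-\bar\varphi(\bar\eta)+\delta(x)\quad\forall\eta\in\omega_1\setminus B_{\varepsilon_0}(\bar\eta),$$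 and $u_0(\{x\in\omega_0:\delta(x)\le\kappa\})\le C\kappa$ for all $\kappa\ge0$. Then the condition $$\mathcal F''(\bar u)h^2+\frac\alpha2\mathcal D''(\bar u,\bar\varphi;h)>0\qquad\forall h\in C^1(\omega_1)^*\setminus\{0\}$$ is equivalent to the existence of $\kappa,\varepsilon>0$ such that the quadratic growth condition $$F(u)+\frac\alpha2D(u)\ge F(\bar u)+\frac\alpha2D(\bar u)+\frac\kappa2\|u-\bar u\|_{\mathrm{BL}}^2\qquad\forall u\in\mathcal M(\omega_1)\text{ with }\|u-\bar u\|_{\mathrm{BL}}\le\varepsilon$$ holds.
   Context: Standing assumptions: $d\in\mathbb N$; $\omega_0,\omega_1\subset\mathbb R^d$ are compact; $\omega_1$ is the closure of its interior and $\operatorname{int}\omega_1$ is uniformly locally quasiconvex (a set $A\subset\mathbb R^d$ is so if there are $r>0$, $C\ge1$ such that any $x,y\in A$ with $|x-y|\le r$ can be joined by a curve $\gamma\in C([0,1];A)$, $\gamma(0)=x,\gamma(1)=y$, with Lipschitz constant at most $C|x-y|$); $c\colon\omega_0\times\omega_1\to\mathbb R$ is continuous; $u_0\in\mathcal M(\omega_0)$, $u_0\ge0$, $u_0(\omega_0)>0$, $\operatorname{supp}(u_0)=\omega_0$; $\bar u\in\mathcal M(\omega_1)$ is fixed with $\bar u\ge0$, $\bar u(\omega_1)=u_0(\omega_0)$. $\mathcal M(\omega)=C(\omega)^*$ denotes the (signed, finite) Borel measures on $\omega$. $B_r(x)$ is the closed ball. $\alpha>0$. Spaces: $C^1(\omega_1)$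 is the Banach space of $\varphi\in C(\omega_1)$ continuously differentiable on $\operatorname{int}\omega_1$ with $\nabla\varphi$ extending continuously to $\omega_1$, normed by $\max\{\|\varphi\|_{C(\omega_1)},\|\nabla\varphi\|_{C(\omega_1;\mathbb R^d)}\}$. $C^1(\omega_1)^*$ is its dual with dual norm. $\Pi\colon\mathcal M(\omega_1)\to C^1(\omega_1)^*$, $\langle\Pi\mu,\varphi\rangle=\int\varphi\,d\mu$, is injective, and $\bar u$ is identified with $\Pi\bar u$. Bounded Lipschitz norm: $\|u\|_{\mathrm{BL}}=\sup\{\int\varphi\,du:\varphi\in C(\omega_1),\max\{\|\varphi\|_{C(\omega_1)},\mathrm{Lip}(\varphi)\}\le1\}$, with $\mathrm{Lip}(\varphi)$ the smallest Lipschitz constant. Functionals: for $u\in\mathcal M(\omega_1)$, $D(u)=\inf\{\int c\,d\pi:\pi\in\mathcal M(\omega_0\times\omega_1),\pi\ge0,P_0\#\pi=u_0,P_1\#\pi=u\}$, $P_i$ the projection onto $\omega_i$ ($\inf\emptyset=+\infty$). $\mathcal D\colon C^1(\omega_1)^*\to\mathbb R\cup\{\infty\}$ is $\mathcal D(\Pi u)=D(u)$ and $\mathcal D=\infty$ outside $\operatorname{ran}\Pi$; $\operatorname{dom}(\mathcal D)=\{\mathcal D<\infty\}$. $F\colon\mathcal M(\omega_1)\to\mathbb R$ is given and $\mathcal F\colon C^1(\omega_1)^*\to\mathbb R$ is an extension, i.e. $\mathcal F(\Pi u)=F(u)$ (values outside $\operatorname{ran}\Pi$ are irrelevant). $\mathcal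 F''(\bar u)h^2:=\mathcal F''(\bar u)[h,h]$. Kantorovich potential for $u$: a function $\psi\in C(\omega_1)$ with $\int_{\omega_1}\psi\,du+\int_{\omega_0}\psi^{\bar c}\,du_0=D(u)$, where $\psi^{\bar c}(x)=\inf_{\eta\in\omega_1}c(x,\eta)-\psi(\eta)$. Weak-$\star$ second subderivative: $\mathcal D''(\bar u,\bar\varphi;h)=\inf\{\liminf_{k\to\infty}\frac{\mathcal D(\bar u+t_kh_k)-\mathcal D(\bar u)-t_k\langle\bar\varphi,h_k\rangle}{t_k^2/2}\}$, infimum over all sequences $(t_k)\subset(0,\infty)$, $t_k\to0$ and $(h_k)\subset C^1(\omega_1)^*$, $h_k\stackrel{\star}{\rightharpoonup}h$. *)

(* Defs.v *)
From HB Require Import structures.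
From mathcomp Require Import all_boot all_order all_algebra.
From mathcomp Require Import all_classical all_reals all_analysis.
From mathcomp Require Import measurable_realfun.

Set Implicit Arguments.
Unset Strict Implicit.
Unset Printing Implicit Defensive.

Import Order.TTheory GRing.Theory Num.Theory.
Import numFieldNormedType.Exports.

Local Open Scope classical_set_scope.
Local Open Scope ring_scope.

(* R^d with its Borel sigma-algebra. *)
Notation borelRd R d := (g_sigma_algebraType (@open 'rV[R]_d)).

(* Integral of a real function against a signed measure, through its Jordan
   decomposition. *)
Section charge_integral.
Context d (T : measurableType d) (R : realType).
Variable nu : {charge set T -> \bar R}.

Definition hahn_pos : set T := sval (cid (Hahn_decomposition nu)).
Definition hahn_neg : set T := sval (cid (svalP (cid (Hahn_decomposition nu)))).
Definition hahn_posneg : hahn_decomposition nu hahn_pos hahn_neg :=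
  svalP (cid (svalP (cid (Hahn_decomposition nu)))).

Definition cintegral (D : set T) (f : T -> R) : R :=
  \int[jordan_pos hahn_posneg]_(x in D) f x -
  \int[jordan_neg hahn_posneg]_(x in D) f x.

End charge_integral.

Section euclidean.
Context {R : realType} {d : nat}.
Implicit Types x y : 'rV[R]_d.

(* The library norm on ['rV[R]_d] is the maximum norm. *)
Definition enorm x : R := Num.sqrt (\sum_(i < d) x 0 i ^+ 2).

Definition uniformly_locally_quasiconvex (A : set 'rV[R]_d) :=
  exists r C : R, [/\ 0 < r, 1 <= C &
    forall x y, A x -> A y -> enorm (x - y) <= r ->
    exists gamma : R -> 'rV[R]_d,
      [/\ {within `[0, 1], continuous gamma},
          forall t, t \in `[0, 1] -> A (gamma t),
          gamma 0 = x, gamma 1 = y &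
          forall s t, s \in `[0, 1] -> t \in `[0, 1] ->
            enorm (gamma s - gamma t) <= C * enorm (x - y) * `|s - t| ]].

Definition gradient (f : 'rV[R]_d -> R) x : 'rV[R]_d :=
  \row_i ('d f x : 'rV[R]_d -> R) (delta_mx 0 i).

End euclidean.

Section C1.
Context {R : realType} {d : nat}.
Variable omega : set 'rV[R]_d.
Implicit Types (f : 'rV[R]_d -> R) (a : R).

Definition supnorm f : R := sup [set `|f x| | x in omega].

Definition gradient_extension f (g : 'rV[R]_d -> 'rV[R]_d) :=
  {within omega, continuous g} /\ forall x, omega° x -> g x = gradient f x.

(* A function on [omega] is represented by its extension by zero to R^d, so
   that equality in [C1] is equality on [omega]. *)
Definition is_C1 f :=
  [/\ forall x, ~ omega x -> f x = 0,
      {within omega, continuous f},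
      forall x, omega° x -> differentiable f x &
      exists g, gradient_extension f g].

Definition C1_pred : {pred 'rV[R]_d -> R} := fun f => `[< is_C1 f >].

Lemma C1_submod_closed : submod_closed C1_pred.
Proof.
split.
  apply/asboolP; split.
  - by [].
  - by move=> x; exact: cvg_cst.
  - by move=> x _; exact: differentiable_cst.
  - exists (cst 0); split; first by move=> x; exact: cvg_cst.
    by move=> x _; apply/rowP => i; rewrite !mxE diff_cst.
move=> a f g /asboolP[f0 cf df [gf [cgf gfE]]] /asboolP[g0 cg dg [gg [cgg ggE]]].
apply/asboolP; split.
- move=> x ox; have -> : (a *: f + g) x = a * f x + g x by [].
  by rewrite f0// g0// mulr0 addr0.
- by move=> x; apply: cvgD; [apply: cvgZr; exact: cf|exact: cg].
- move=> x ox; apply: differentiableD; last exact: dg.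
  by apply: differentiableZ; exact: df.
- exists (fun x => a *: gf x + gg x); split.
    by move=> x; apply: cvgD; [apply: cvgZr; exact: cgf|exact: cgg].
  move=> x ox; rewrite gfE// ggE//; apply/rowP => i; rewrite !mxE.
  rewrite diffD; [|by apply: differentiableZ; exact: df|exact: dg].
  by rewrite diffZ//; exact: df.
Qed.

HB.instance Definition _ :=
  GRing.isSubmodClosed.Build R ('rV[R]_d -> R) C1_pred C1_submod_closed.

Record C1 := MkC1 { C1_fun :> 'rV[R]_d -> R ; C1_funP : C1_fun \in C1_pred }.

HB.instance Definition _ := [isSub for C1_fun].
HB.instance Definition _ := [Choice of C1 by <:].
HB.instance Definition _ := [SubChoice_isSubLmodule of C1 by <:].

Lemma C1P (phi : C1) : is_C1 phi.
Proof. exact/asboolP/(C1_funP phi). Qed.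

Lemma C1_gradient_exists (phi : C1) : exists g, gradient_extension phi g.
Proof. by have [] := C1P phi. Qed.

(* Unique on [omega] when [omega] is the closure of its interior. *)
Definition C1_gradient (phi : C1) : 'rV[R]_d -> 'rV[R]_d :=
  sval (cid (C1_gradient_exists phi)).

Definition C1_norm (phi : C1) : R :=
  Num.max (supnorm phi) (supnorm (enorm \o C1_gradient phi)).

Definition C1_dual_pred : {pred C1 -> R} := fun L =>
  `[< (forall a phi psi, L (a *: phi + psi) = a * L phi + L psi) /\
      exists M, forall phi, `|L phi| <= M * C1_norm phi >].

Lemma C1_dual_submod_closed : submod_closed C1_dual_pred.
Proof.
split.
  apply/asboolP; split=> [a phi psi|]; first by rewrite mulr0 addr0.
  by exists 0 => phi; rewrite normr0 mul0r.
move=> a L1 L2 /asboolP[lin1 [M1 bd1]] /asboolP[lin2 [M2 bd2]].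
apply/asboolP; split=> [b phi psi|].
  have E chi : (a *: L1 + L2) chi = a * L1 chi + L2 chi by [].
  rewrite !E lin1 lin2 !mulrDr !mulrA (mulrC a b) -!addrA; congr (_ + _).
  by rewrite addrCA.
exists (`|a| * M1 + M2) => phi; rewrite mulrDl -mulrA.
rewrite (le_trans (ler_normD _ _))// lerD// normrM.
exact: ler_wpM2l.
Qed.

HB.instance Definition _ :=
  GRing.isSubmodClosed.Build R (C1 -> R) C1_dual_pred C1_dual_submod_closed.

Record C1_dual := MkC1_dual {
  C1_dual_fun :> C1 -> R ; C1_dual_funP : C1_dual_fun \in C1_dual_pred }.

HB.instance Definition _ := [isSub for C1_dual_fun].
HB.instance Definition _ := [Choice of C1_dual by <:].
HB.instance Definition _ := [SubChoice_isSubLmodule of C1_dual by <:].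

Definition C1_dual_norm (xi : C1_dual) : R :=
  sup [set `|xi phi| | phi in [set phi : C1 | C1_norm phi <= 1]].

Definition weak_star_cvg (xi_ : nat -> C1_dual) (xi : C1_dual) :=
  forall phi : C1, xi_ k phi @[k --> \oo] --> xi phi.

Definition bounded_bilinear (B : C1_dual -> C1_dual -> R) :=
  bilinear_for *%R *%R B /\
  exists M, forall xi zeta,
    `|B xi zeta| <= M * C1_dual_norm xi * C1_dual_norm zeta.

Definition weak_star_subderivative2 (G : C1_dual -> \bar R)
    (xi : C1_dual) (phi : C1) (h : C1_dual) : \bar R :=
  ereal_inf [set l | exists (t : nat -> R) (h_ : nat -> C1_dual),
    [/\ forall k, 0 < t k, t @ \oo --> 0, weak_star_cvg h_ h &
        l = limn_einf (fun k =>
          (G (xi + t k *: h_ k)%R - G xi - (t k * h_ k phi)%:E)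
             * ((t k ^+ 2 / 2)^-1)%:E)%E ]].

End C1.

Section measures.
Context {R : realType} {d : nat}.
Variable omega : set 'rV[R]_d.
Implicit Types (f : 'rV[R]_d -> R) (phi : C1 omega).

Definition concentrated (mu : set (borelRd R d) -> \bar R) :=
  forall A : set (borelRd R d), measurable A -> A `&` omega = set0 -> mu A = 0%E.

(* The signed finite Borel measures on [omega]. *)
Record signed_measure := SignedMeasure {
  signed_charge :> {charge set (borelRd R d) -> \bar R} ;
  signed_chargeP : concentrated signed_charge }.

Definition measure_support (mu : {measure set (borelRd R d) -> \bar R}) :=
  [set x : 'rV[R]_d | forall U : set 'rV[R]_d, open U -> U x -> (0 < mu U)%E].

Definition Lip f : \bar R :=
  ereal_inf [set L%:E | L in [set L | 0 <= L /\
    forall x y, omega x -> omega y -> `|f x - f y| <= L * enorm (x - y)]].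

Definition BL_norm (nu : {charge set (borelRd R d) -> \bar R}) : R :=
  sup [set cintegral nu omega f | f in
    [set f | {within omega, continuous f} /\
             (maxe (supnorm omega f)%:E (Lip f) <= 1)%E]].

Lemma compact_measurable_borel :
  compact omega -> measurable (omega : set (borelRd R d)).
Proof.
move=> cK; rewrite -(setCK omega); apply: measurableC.
apply: sub_sigma_algebra => /=; apply: closed_openC.
by apply: compact_closed => //; exact: norm_hausdorff.
Qed.

Lemma continuous_measurable_borel f :
  compact omega -> {within omega, continuous f} ->
  measurable_fun (omega : set (borelRd R d)) f.
Proof.
move=> cK cf; apply: (measurability _ (RGenOpens.measurableE R)) => //.
move=> _ [_ [a [b ->]] <-].
have oI : open `]a, b[%classic by exact: interval_open.
have /continuousP/(_ _ oI)/open_subspaceP[V oV VE] := cf.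
rewrite setIC -VE; apply: measurableI; first exact: sub_sigma_algebra.
exact: compact_measurable_borel.
Qed.

Lemma continuous_bounded f : compact omega -> {within omega, continuous f} ->
  [bounded f x | x in omega].
Proof.
move=> cK cf; have [M [Mr bM]] := compact_bounded (continuous_compact cf cK).
by exists M; split => // x Mx y oy /=; apply: (bM _ Mx); exists y.
Qed.

Lemma C1_norm_ge phi x : compact omega -> omega x -> `|phi x| <= C1_norm phi.
Proof.
move=> cK ox; rewrite /C1_norm le_max; apply/orP; left.
apply: ub_le_sup; last by exists x.
have [_ cphi _ _] := C1P phi.
have [M [_ bM]] := continuous_bounded cK cphi.
by exists (M + 1) => _ [y oy <-]; apply: bM => //; rewrite ltrDl.
Qed.

Section integral.
Variable mu : {finite_measure set (borelRd R d) -> \bar R}.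
Hypothesis cK : compact omega.

Let C1_integrable phi : mu.-integrable omega (EFin \o phi).
Proof.
have [_ cphi _ _] := C1P phi.
apply: measurable_bounded_integrable => //.
- exact: compact_measurable_borel.
- by rewrite ltey_eq fin_num_measure//; exact: compact_measurable_borel.
- exact: continuous_measurable_borel.
- exact: continuous_bounded.
Qed.

Lemma C1_Rintegral_linear a phi psi :
  \int[mu]_(x in omega) (a *: phi + psi) x =
  a * \int[mu]_(x in omega) phi x + \int[mu]_(x in omega) psi x.
Proof.
have mK := compact_measurable_borel cK.
rewrite -RintegralZl// -RintegralD//.
exact: (C1_integrable (a *: phi)).
Qed.

Lemma C1_Rintegral_bounded phi :
  `|\int[mu]_(x in omega) phi x| <= fine (mu omega) * C1_norm phi.
Proof.
have mK := compact_measurable_borel cK.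
rewrite (le_trans (le_normr_Rintegral _ _))//.
rewrite mulrC -Rintegral_cst//; apply: le_Rintegral => //.
- exact: (integrable_norm (C1_integrable phi)).
- by apply: finite_measure_integrable_cst.
- by move=> x ox; exact: C1_norm_ge.
Qed.

End integral.

Lemma Pi_subproof (cK : compact omega) (mu : signed_measure) :
  (fun phi => cintegral mu omega phi) \in @C1_dual_pred R d omega.
Proof.
apply/asboolP; split=> [a phi psi|].
  by rewrite /cintegral !C1_Rintegral_linear// mulrBr opprD addrACA.
exists (fine (jordan_pos (hahn_posneg mu) omega)
      + fine (jordan_neg (hahn_posneg mu) omega)) => phi.
rewrite (le_trans (ler_normB _ _))// mulrDl lerD//.
- exact: C1_Rintegral_bounded.
- exact: C1_Rintegral_bounded.
Qed.

Definition Pi (cK : compact omega) (mu : signed_measure) : C1_dual omega :=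
  MkC1_dual (Pi_subproof cK mu).

End measures.

Section transport.
Context {R : realType} {d : nat}.
Variables omega0 omega1 : set 'rV[R]_d.
Variable c : 'rV[R]_d -> 'rV[R]_d -> R.
Variable u0 : {finite_measure set (borelRd R d) -> \bar R}.

(* When [u0] is concentrated on [omega0], the marginal conditions force [pi] to
   be concentrated on [omega0 `*` omega1] and to be finite. *)
Definition coupling (u : signed_measure omega1)
    (pi : {measure set (borelRd R d * borelRd R d) -> \bar R}) :=
  (forall A, measurable A -> pi (A `*` setT) = u0 A) /\
  (forall B, measurable B -> pi (setT `*` B) = u B).

Definition transport_cost (u : signed_measure omega1) : \bar R :=
  ereal_inf [set (\int[pi]_(z in omega0 `*` omega1) (c z.1 z.2)%:E)%E
            | pi in coupling u].

(* [Pi] is injective up to the values of charges on non-measurable sets, which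
   do not affect [transport_cost]. *)
Definition dual_transport_cost (cK : compact omega1)
    (xi : C1_dual omega1) : \bar R :=
  if pselect (exists u, Pi cK u = xi) is left ex
  then transport_cost (sval (cid ex)) else +oo%E.

Definition c_transform (psi : 'rV[R]_d -> R) (x : 'rV[R]_d) : R :=
  inf [set c x eta - psi eta | eta in omega1].

Definition kantorovich_potential (u : signed_measure omega1)
    (psi : 'rV[R]_d -> R) :=
  {within omega1, continuous psi} /\
  (cintegral u omega1 psi +
   \int[u0]_(x in omega0) c_transform psi x)%:E = transport_cost u.

End transport.

(* Main.v *)
Require Import Defs.
From HB Require Import structures.
From mathcomp Require Import all_boot all_order all_algebra.
From mathcomp Require Import all_classical all_reals all_analysis.
From mathcomp Require Import measurable_realfun.
From mathcomp Require Import ring lra.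

Set Implicit Arguments.
Unset Strict Implicit.
Unset Printing Implicit Defensive.

Import Order.TTheory GRing.Theory Num.Theory.
Import numFieldNormedType.Exports.

Local Open Scope classical_set_scope.
Local Open Scope ring_scope.

(** The implication from quadratic growth to the second-order condition is the
easy one. If [h_k] converges to a nonzero [h] in the weak-star sense, then the
growth inequality at the measures [ubar + t_k h_k], divided by [t_k ^+ 2 / 2],
bounds [F'' h_k h_k] plus the difference quotients of the transport cost from
below by a multiple of [(h_k phi) ^+ 2], where [phi] is some C1 function with
[h phi != 0] ([growth_second_order]). The growth inequality applies because
nonnegative measures of equal mass that converge weakly-star in the dual of C1
converge in the bounded Lipschitz norm ([BL_norm_cvg0]), and the lower bound
holds because a C1 function on a quasiconvex set is Lipschitz, with a constant
proportional to its C1 norm ([C1_lipschitz]).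

For the converse, suppose that growth fails along measures [u_k] and normalise
[u_k - ubar] by its bounded Lipschitz norm. The resulting functionals are bounded
in the dual of the separable space C1, so that a subsequence converges weakly-star
([weak_star_seq_compact]). The second-order condition excludes a nonzero limit.
It remains to exclude the limit 0, along which the second-order condition says
nothing. This is the purpose of the assumption on the transport map: it implies

  D(u) - D(ubar) - <phibar, u - ubar> >= a * |u - ubar|_BL ^+ 2

for all [u] of finite cost ([transport_quadratic_growth]), so that the difference quotients of the
transport cost stay away from 0 whatever the direction.

This inequality comes from duality. For a coupling of [u0] and [u], the integral of
[c(x, eta) - phibar(eta) - phibar^c(x)] is its cost minus the dual value. The
integrand dominates a multiple of the squared distance from [eta] to [Tbar x] if
the two points are close, and [delta x] if they are not, while [delta] is at most [k] on a set of
mass at most [C * k] only. For a test function [f] and every [k > 0] this bounds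
the integral of [f eta - f (Tbar x)] by a multiple of [k] plus a multiple of
[1 / k] times the suboptimality of the coupling ([coupling_test_le]). The infimum
over couplings of [ubar] has suboptimality 0, whence [ubar] is the image of [u0]
under [Tbar] as far as test functions are concerned ([ubar_test]); optimising over
[k] for [u] gives the square.

Finally, the transport cost on the dual of C1 is well defined because measures are
determined by their integrals against C1 functions ([Pi_inj]). This density, the
convergence in the bounded Lipschitz norm and the measurability of the cost all
rest on one family of C1 partitions of unity ([C1_partition_of_unity]). *)

(** * Uniform continuity and nets on compact sets *)

Section compactness.
Context {R : realType} {V W : normedModType R}.

Lemma within_continuous_eps (A : set V) (f : V -> W) x e :
  {within A, continuous f} -> A x -> 0 < e ->
  exists2 r, 0 < r & forall y, A y -> `|x - y| < r -> `|f x - f y| < e.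
Proof.
move=> cf Ax e0.
have /cvgrPdist_lt/(_ e e0) := cf x.
rewrite /nbhs/= -nbhs_subspace_in// => /nbhs_ballP[r/= r0 H].
exists r => // y Ay xy; apply: H => //.
by rewrite -ball_normE.
Qed.

Lemma eps_within_continuous (A : set V) (f : V -> W) :
  (forall x e, A x -> 0 < e ->
    exists2 r, 0 < r & forall y, A y -> `|x - y| < r -> `|f x - f y| < e) ->
  {within A, continuous f}.
Proof.
move=> H; apply/subspace_continuousP => x Ax; apply/cvgrPdist_lt => e e0.
have [r r0 Hr] := H x e Ax e0.
rewrite near_withinE; apply/nbhs_ballP; exists r => //= y xy Ay.
by apply: Hr => //; rewrite -ball_normE in xy.
Qed.

(** Half of the modulus of continuity at a point serves for all nearby points, so
that a positive modulus exists locally; compactness makes it global. *)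
Lemma compact_uniform_continuous (K : set V) (f : V -> W) e :
  compact K -> {within K, continuous f} -> 0 < e ->
  exists2 r, 0 < r & forall x y, K x -> K y -> `|x - y| < r -> `|f x - f y| < e.
Proof.
move=> cK cf e0.
have e20 : 0 < e / 2 by rewrite divr_gt0.
move/compact_near_coveringP : cK.
pose P (r : R) (x : V) := K x -> forall y, K y -> `|x - y| < r -> `|f x - f y| < e.
move/(_ R (0^'+) P _) => /= H.
have : \forall i \near 0^'+, K `<=` P i.
  apply: H => x Kx.
  have [r r0 Hr] := within_continuous_eps cf Kx e20.
  have r20 : 0 < r / 2 by rewrite divr_gt0.
  exists (ball x (r / 2), [set s | s < r / 2]) => /=.
    split; first exact: nbhsx_ballx.
    exact: nbhs_right_lt.
  move=> [x' s] /= [xx' sr] Kx' y Ky x'y.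
  move: xx'; rewrite -ball_normE/= => xx'.
  rewrite -[f x'](subrK (f x)) -addrA (le_lt_trans (ler_normD _ _))//.
  rewrite [e]splitr ltrD//.
    by rewrite distrC; apply: Hr => //; rewrite (lt_trans xx')// gtr_pMr// invf_lt1 ?ltr1n.
  apply: Hr => //.
  rewrite -[x](subrK x') -addrA (le_lt_trans (ler_normD _ _))// [r]splitr ltrD//.
  exact: lt_trans sr.
case=> s /= s0 Hs.
exists (s / 2); first by rewrite divr_gt0.
move=> x y Kx Ky xy; apply: (Hs (s / 2)) => //=.
  by rewrite sub0r normrN gtr0_norm ?divr_gt0// gtr_pMr// invf_lt1 ?ltr1n.
by rewrite divr_gt0.
Qed.

Lemma compact_finite_net (K : set V) e : compact K -> 0 < e ->
  exists s : seq V, (forall x, x \in s -> K x) /\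
    forall x, K x -> exists2 y, y \in s & `|x - y| < e.
Proof.
move=> + e0; rewrite compact_cover => /(_ V K (fun x => ball x e)) [].
- by move=> x _; exact: ball_open.
- by move=> x Kx; exists x => //; exact: ballxx.
move=> D DK KD; exists (finmap.enum_fset D); split => [x xD|x /KD[y /= yD]].
  by move: (DK x xD); rewrite inE.
by rewrite -ball_normE/= distrC; exists y.
Qed.

End compactness.

(** * Differentials and the Euclidean norm *)

Lemma cvg_sum {R : realType} {V : normedModType R} (T I : Type)
    (F : set_system T) {FF : Filter F} (r : seq I) (f : I -> T -> V) (l : I -> V) :
  (forall i, f i x @[x --> F] --> l i) ->
  \sum_(i <- r) f i x @[x --> F] --> \sum_(i <- r) l i.
Proof.
move=> H; elim: r => [|i r IH].
  by under eq_fun do rewrite big_nil; rewrite big_nil; exact: cvg_cst.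
by under eq_fun do rewrite big_cons; rewrite big_cons; apply: cvgD.
Qed.

Section differentiability.
Context {R : realType} {V W : normedModType R}.

Lemma differentiable_eps (f : V -> W) x e : differentiable f x -> 0 < e ->
  \forall h \near 0, `|f (h + x) - f x - 'd f x h| <= e * `|h|.
Proof.
move=> df e0; have /eqaddoP/(_ e e0) := diff_locally df.
apply: filterS => h /=; by rewrite !fctE/= opprD addrA.
Qed.

(** A function of [C1 omega] vanishes outside [omega], so that a formula for it
holds only near the interior points; its differential is computed from there. *)
Lemma near_eq_differentiable (f g : V -> W) x : (\near x, f x = g x) ->
  differentiable f x -> differentiable g x /\ 'd g x = 'd f x :> (V -> W).
Proof.
move=> fg df; have gx : f x = g x by exact: nbhs_singleton fg.
have fg0 : \forall h \near 0, f (h + x) = g (h + x).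
  by move: fg; rewrite (near_shift 0)/=; apply: filterS => h /=; rewrite subr0.
have H : g \o shift x = cst (g x) + 'd f x +o_ 0 id.
  apply/eqaddoP => e e0; near=> h; rewrite !fctE/= opprD addrA -gx.
  by rewrite -(near fg0 h)//; near: h; exact: differentiable_eps.
have E : 'd g x = 'd f x :> (V -> W) by apply: diff_unique => //; exact: diff_continuous.
split => //; apply/diff_locallyP; rewrite E; split => //; exact: diff_continuous.
Unshelve. all: by end_near. Qed.

End differentiability.

Section euclidean_norm.
Context {R : realType} {d : nat}.
Implicit Types x y : 'rV[R]_d.

Definition dotp x y : R := \sum_(i < d) x 0 i * y 0 i.

Lemma enorm_sqr x : enorm x ^+ 2 = \sum_(i < d) x 0 i ^+ 2.
Proof. by rewrite sqr_sqrtr// sumr_ge0// => i _; exact: sqr_ge0. Qed.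

Lemma enorm_ge0 x : 0 <= enorm x. Proof. exact: sqrtr_ge0. Qed.

Lemma coord_le_enorm x i : `|x 0 i| <= enorm x.
Proof.
rewrite -(@ler_pXn2r _ 2) ?nnegrE ?enorm_ge0// enorm_sqr real_normK ?num_real//.
rewrite (bigD1 i)//= lerDl sumr_ge0// => j _; exact: sqr_ge0.
Qed.

Lemma rV_norm_le x (e : R) : 0 <= e -> (forall i, `|x 0 i| <= e) -> `|x| <= e.
Proof.
move=> e0 H; rewrite [leLHS]/Num.norm/= mx_normrE.
by apply: bigmax_le => // -[i j] _ /=; rewrite ord1.
Qed.

Lemma coord_le_norm x i : `|x 0 i| <= `|x|.
Proof.
rewrite [leRHS]/Num.norm/= mx_normrE.
by apply: (le_bigmax _ (fun i => `|x i.1 i.2|) (0, i)).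
Qed.

Lemma norm_le_enorm x : `|x| <= enorm x.
Proof. by apply: rV_norm_le (enorm_ge0 x) _ => i; exact: coord_le_enorm. Qed.

Lemma enorm_le_norm x : enorm x <= d%:R * `|x|.
Proof.
rewrite -(@ler_pXn2r _ 2) ?nnegrE ?enorm_ge0 ?mulr_ge0// enorm_sqr.
apply: (@le_trans _ _ (\sum_(i < d) `|x| ^+ 2)).
  apply: ler_sum => i _; rewrite -real_normK ?num_real//.
  by rewrite ler_pXn2r ?nnegrE// coord_le_norm.
rewrite sumr_const card_ord -[leLHS]mulr_natl exprMn; apply: ler_wpM2r; first exact: sqr_ge0.
by rewrite -natrX ler_nat; case: (d) => // n; rewrite leq_pmulr.
Qed.

(** Cauchy-Schwarz from the Lagrange identity: the defect is half the sum of the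
squares of [x i * y j - x j * y i]. *)
Lemma dotp_le_enorm x y : `|dotp x y| <= enorm x * enorm y.
Proof.
rewrite -(@ler_pXn2r _ 2) ?nnegrE ?mulr_ge0 ?enorm_ge0//.
rewrite real_normK ?num_real// exprMn !enorm_sqr -subr_ge0.
suff -> : (\sum_(i < d) x 0 i ^+ 2) * (\sum_(i < d) y 0 i ^+ 2) - dotp x y ^+ 2 =
  (\sum_(i < d) \sum_(j < d) (x 0 i * y 0 j - x 0 j * y 0 i) ^+ 2) / 2.
  by rewrite divr_ge0// sumr_ge0// => i _; rewrite sumr_ge0// => j _; exact: sqr_ge0.
have -> : \sum_(i < d) \sum_(j < d) (x 0 i * y 0 j - x 0 j * y 0 i) ^+ 2 =
  \sum_(i < d) \sum_(j < d) (x 0 i ^+ 2 * y 0 j ^+ 2) +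
  \sum_(i < d) \sum_(j < d) (x 0 j ^+ 2 * y 0 i ^+ 2) -
  2 * \sum_(i < d) \sum_(j < d) ((x 0 i * y 0 i) * (x 0 j * y 0 j)).
  rewrite mulr_sumr -big_split/= -sumrB; apply: eq_bigr => i _.
  rewrite mulr_sumr -big_split/= -sumrB; apply: eq_bigr => j _; ring.
rewrite [X in _ + X - _]exchange_big/=.
have -> : \sum_(i < d) \sum_(j < d) (x 0 i ^+ 2 * y 0 j ^+ 2) =
  (\sum_(i < d) x 0 i ^+ 2) * (\sum_(i < d) y 0 i ^+ 2).
  by rewrite mulr_suml; apply: eq_bigr => i _; rewrite mulr_sumr.
have -> : \sum_(i < d) \sum_(j < d) ((x 0 i * y 0 i) * (x 0 j * y 0 j)) = dotp x y ^+ 2.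
  by rewrite expr2 /dotp mulr_suml; apply: eq_bigr => i _; rewrite mulr_sumr.
by field.
Qed.

Lemma enorm_continuous : continuous (@enorm R d).
Proof.
move=> x; apply: (@continuous_comp _ _ _ (fun x : 'rV[R]_d =>
  \sum_(i < d) x 0 i ^+ 2) Num.sqrt).
  apply: (@cvg_sum _ _ _ _ (nbhs x) _ _ (fun i (y : 'rV[R]_d) => y 0 i ^+ 2)) => i.
  by apply: (@continuous_comp _ _ _ (fun x : 'rV[R]_d => x 0 i) (fun a => a ^+ 2));
    [exact: coord_continuous|exact: exprn_continuous].
exact: sqrt_continuous.
Qed.

Lemma diff_gradient (f : 'rV[R]_d -> R) x h : 'd f x h = dotp (gradient f x) h.
Proof.
have {1}-> : h = \sum_(i < d) h 0 i *: delta_mx 0 i by exact: row_sum_delta.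
rewrite linear_sum/=; apply: eq_bigr => i _.
by rewrite linearZ/= mxE mulrC.
Qed.

End euclidean_norm.

Section gradient.
Context {R : realType} {d : nat}.
Implicit Types f : 'rV[R]_d -> R.

Lemma gradient_derive f x : differentiable f x ->
  gradient f x = \row_i 'D_(delta_mx 0 i) f x.
Proof.
move=> df; rewrite /gradient; congr (\matrix_(_, _) _).
by apply/funext => i; apply/funext => j; rewrite (deriveE _ df).
Qed.

Lemma gradientD f (g : 'rV[R]_d -> R) x : differentiable f x ->
  differentiable g x -> gradient (f \+ g) x = gradient f x + gradient g x.
Proof.
move=> df dg.
rewrite (gradient_derive (differentiableD df dg)) (gradient_derive df) (gradient_derive dg).
apply/rowP => i; rewrite mxE [RHS]mxE 2![in RHS]mxE.
by rewrite (deriveD (diff_derivable df) (diff_derivable dg)).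
Qed.

Lemma gradientM f (g : 'rV[R]_d -> R) x : differentiable f x ->
  differentiable g x ->
  gradient (f \* g) x = f x *: gradient g x + g x *: gradient f x.
Proof.
move=> df dg.
rewrite (gradient_derive (differentiableM df dg)) (gradient_derive df) (gradient_derive dg).
apply/rowP => i; rewrite mxE [RHS]mxE 4![in RHS]mxE.
by rewrite (deriveM (diff_derivable df) (diff_derivable dg)).
Qed.

Lemma gradient_comp f (p : R -> R) (q : R) x : differentiable f x ->
  is_derive (f x) (1 : R) p q -> gradient (p \o f) x = q *: gradient f x.
Proof.
move=> df dp.
have dp' : derivable p (f x) 1 by exact: ex_derive.
have dpf : differentiable p (f x) by apply/derivable1_diffP.
apply/rowP => i; rewrite mxE [RHS]mxE [in RHS]mxE.
rewrite (diff_comp df dpf) /comp (deriv1E dp') derive1E derive_val.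
by rewrite mulrC.
Qed.

End gradient.

(** * Stability of continuous differentiability on a compact set *)

Section C1_functions.
Context {R : realType} {d : nat}.
Variable omega : set 'rV[R]_d.
Implicit Types f : 'rV[R]_d -> R.

(** Membership in [C1 omega] before the extension by zero: in contrast to [is_C1],
it holds for nonzero constants, so that formulas can be built up from them. *)
Definition C1_on f := [/\ {within omega, continuous f},
  forall x, omega° x -> differentiable f x & exists g, gradient_extension omega f g].

Lemma C1_on_cst a : C1_on (cst a).
Proof.
split; first by move=> x; exact: cvg_cst.
- by move=> x _; exact: differentiable_cst.
- exists (cst 0); split; first by move=> x; exact: cvg_cst.
  by move=> x _; apply/rowP => i; rewrite mxE [RHS]mxE diff_cst.
Qed.

Lemma C1_on_coord i : C1_on (fun x => x 0 i).
Proof.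
have lin : linear (fun x : 'rV[R]_d => x 0 i : R) by move=> a x y; rewrite !mxE.
pose L : {linear 'rV[R]_d -> R} := HB.pack (fun x : 'rV[R]_d => x 0 i : R)
  (GRing.isLinear.Build _ _ _ _ _ lin).
have cL : continuous L by exact: coord_continuous.
split; first by apply: continuous_subspaceT; exact: coord_continuous.
- by move=> x _; exact: differentiable_coord.
exists (cst (\row_j (j == i)%:R)); split; first by move=> x; exact: cvg_cst.
move=> x _; apply/rowP => j; rewrite mxE [RHS]mxE.
by rewrite (_ : (fun _ => _) = L)// (diff_lin _ cL)//= mxE eqxx eq_sym.
Qed.

Lemma C1_onD f (g : 'rV[R]_d -> R) : C1_on f -> C1_on g -> C1_on (f \+ g).
Proof.
move=> [cf df [gf [cgf gfE]]] [cg dg [gg [cgg ggE]]]; split.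
- by move=> x; apply: cvgD; [exact: cf|exact: cg].
- by move=> x ox; apply: differentiableD; [exact: df|exact: dg].
exists (fun x => gf x + gg x); split; first by move=> x; apply: cvgD; [exact: cgf|exact: cgg].
by move=> x ox; rewrite (gradientD (df _ ox) (dg _ ox)) (gfE _ ox) (ggE _ ox).
Qed.

Lemma C1_onM f (g : 'rV[R]_d -> R) : C1_on f -> C1_on g -> C1_on (f \* g).
Proof.
move=> [cf df [gf [cgf gfE]]] [cg dg [gg [cgg ggE]]]; split.
- by move=> x; apply: cvgM; [exact: cf|exact: cg].
- by move=> x ox; apply: differentiableM; [exact: df|exact: dg].
exists (fun x => f x *: gg x + g x *: gf x); split.
  by move=> x; apply: cvgD; apply: cvgZ; [exact: cf|exact: cgg|exact: cg|exact: cgf].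
by move=> x ox; rewrite (gradientM (df _ ox) (dg _ ox)) (gfE _ ox) (ggE _ ox).
Qed.

Lemma C1_on_comp f (p p' : R -> R) : (forall x, omega x -> {for f x, continuous p'}) ->
  (forall x, omega x -> is_derive (f x) (1 : R) p (p' (f x))) ->
  C1_on f -> C1_on (p \o f).
Proof.
move=> cp' dp [cf df [gf [cgf gfE]]].
have dp1 x : omega x -> differentiable p (f x).
  by move=> ox; have dpx := dp x ox; apply/derivable1_diffP; exact: ex_derive.
have io x : omega° x -> omega x by exact: interior_subset.
move/subspace_continuousP : cf => cf; move/subspace_continuousP : cgf => cgf.
split.
- apply/subspace_continuousP => x ox; apply: (@cvg_comp _ _ _ f p); first exact: cf.
  by have /differentiable_continuous := dp1 x ox.
- move=> x ox; apply: differentiable_comp; [exact: df|exact/dp1/io].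
exists (fun x => p' (f x) *: gf x); split.
  apply/subspace_continuousP => x ox; apply: cvgZ; last exact: cgf.
  by apply: (@cvg_comp _ _ _ f p'); [exact: cf|exact: cp'].
by move=> x ox; rewrite (gfE _ ox) (gradient_comp (df _ ox) (dp _ (io _ ox))).
Qed.

Lemma C1_on_inv f : (forall x, omega x -> f x != 0) -> C1_on f ->
  C1_on (fun x => (f x)^-1).
Proof.
move=> f0; apply: (@C1_on_comp f (fun a => a^-1) (fun a => - a ^- 2)) => x ox.
  apply: continuousN; apply: continuousV; last exact: exprn_continuous.
  by rewrite expf_neq0// f0.
have D : derivable (@id R) (f x) 1 by exact: derivable_id.
apply: DeriveDef; first by apply: (derivableV (f := id)) => //; exact: f0.
by rewrite (deriveV (f := id) (f0 x ox) D) derive_id scaler1.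
Qed.

Lemma C1_on_sum I (r : seq I) (F : I -> 'rV[R]_d -> R) :
  (forall i, C1_on (F i)) -> C1_on (fun x => \sum_(i <- r) F i x).
Proof.
move=> H; elim: r => [|i r IH].
  have -> : (fun x => \sum_(i <- [::]) F i x) = cst 0.
    by apply/funext => x; rewrite big_nil.
  exact: C1_on_cst.
have -> : (fun x => \sum_(i <- i :: r) F i x) = F i \+ (fun x => \sum_(i <- r) F i x).
  by apply/funext => x; rewrite big_cons.
exact: (C1_onD (H i) IH).
Qed.

Lemma C1_on_is_C1 f : C1_on f -> is_C1 omega (f \_ omega).
Proof.
move=> [cf df [gf [cgf gfE]]].
have nE x : omega° x -> \near x, f x = (f \_ omega) x.
  by apply: filterS => y oy; rewrite patchE mem_set.
split.
- by move=> x ox; rewrite patchE memNset.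
- by apply: subspace_eq_continuous cf => x ox; rewrite /from_subspace patchE ox.
- by move=> x ox; exact: (near_eq_differentiable (nE x ox) (df x ox)).1.
exists gf; split; first exact: cgf.
move=> x ox; transitivity (gradient f x); first exact: gfE.
have [_ E] := near_eq_differentiable (nE x ox) (df x ox).
exact: esym (congr1 (fun L : 'rV[R]_d -> R => \row_i L (delta_mx 0 i)) E).
Qed.

Lemma C1_of f : C1_on f -> exists phi : C1 omega, forall x, omega x -> phi x = f x.
Proof.
move=> /C1_on_is_C1 H; exists (@MkC1 R d omega _ (introT (asboolP _) H)) => x ox.
by rewrite /= patchE mem_set.
Qed.

End C1_functions.

(** * Continuously differentiable partitions of unity *)

Section partition_of_unity.
Context {R : realType} {d : nat}.
Variable omega : set 'rV[R]_d.

(** The square makes the positive part differentiable at 0. *)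
Definition sqpos (y : R) : R := (Num.max 0 y) ^+ 2.

Lemma sqpos_ge0 y : 0 <= sqpos y. Proof. exact: sqr_ge0. Qed.

(** The first-order remainder is at most [h ^+ 2] for all signs of [y] and [h + y],
so that [y = 0] needs no separate treatment. *)
Lemma is_derive_sqpos (y : R) : is_derive y (1 : R) sqpos (2 * Num.max 0 y).
Proof.
have H h : `|sqpos (h + y) - sqpos y - h * (2 * Num.max 0 y)| <= h ^+ 2.
  rewrite /sqpos; have [hy|hy] := lerP 0 (h + y); have [y0|y0] := lerP 0 y;
    by rewrite ler_norml; apply/andP; split; nra.
suff : h^-1 *: (sqpos (h *: 1 + y) - sqpos y) @[h --> 0^'] --> 2 * Num.max 0 y.
  move=> C; apply: DeriveDef; first by apply/cvg_ex; eexists; exact: C.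
  exact: cvg_lim C.
apply/cvgrPdist_le => e e0; near=> h.
have h0 : h != 0 by near: h; exact: nbhs_dnbhs_neq.
have he : `|h| <= e.
  near: h; apply: nbhs_dnbhs; exists e => //= z /=.
  by rewrite sub0r normrN => /ltW.
rewrite distrC -(ler_pM2l (_ : 0 < `|h|)) ?normr_gt0// -normrM mulrBr.
rewrite -[h^-1 *: _]/(h^-1 * _) mulrA mulfV// mul1r [h *: 1]mulr1.
rewrite (le_trans (H h))// -real_normK ?num_real// expr2.
by rewrite ler_wpM2l.
Unshelve. all: by end_near. Qed.

(** The bumps [(e ^+ 2 - enorm (x - y) ^+ 2)_+ ^+ 2] centred at a sufficiently fine
net have a positive sum on [omega]; they are divided by that sum. *)
Lemma C1_partition_of_unity e : compact omega -> 0 < e ->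
  exists (s : seq 'rV[R]_d) (chi : 'rV[R]_d -> C1 omega),
  [/\ forall y, y \in s -> omega y,
      forall y x, omega x -> 0 <= chi y x,
      forall x, omega x -> \sum_(y <- s) chi y x = 1 &
      forall y x, omega x -> chi y x != 0 -> enorm (x - y) <= e ].
Proof.
move=> co e0.
have d1 : 0 < d.+1%:R :> R by rewrite ltr0n.
(* The net is taken for the maximum norm and the bumps for the Euclidean one,
   which is at most [d] times larger. *)
have [s [so sP]] := compact_finite_net co (divr_gt0 e0 d1).
pose rho y (x : 'rV[R]_d) := sqpos (e ^+ 2 - enorm (x - y) ^+ 2).
have rhoC y : C1_on omega (rho y).
  apply: (@C1_on_comp _ _ _ (fun x : 'rV[R]_d => e ^+ 2 - enorm (x - y) ^+ 2)
     sqpos (fun a => 2 * Num.max 0 a)).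
  - move=> x _; apply: cvgM; first exact: cvg_cst.
    apply: (@continuous_max R _ (fun=> 0) id); first exact: cvg_cst.
    exact: cvg_id.
  - by move=> x _; exact: is_derive_sqpos.
  have -> : (fun x : 'rV[R]_d => e ^+ 2 - enorm (x - y) ^+ 2) =
    (cst (e ^+ 2)) \+ (cst (- 1) \*
      (fun x => \sum_(i < d) (((fun x => x 0 i) \+ cst (- y 0 i)) \*
                 ((fun x => x 0 i) \+ cst (- y 0 i))) x)).
    apply/funext => x /=; rewrite mulN1r; congr (_ - _).
    by rewrite enorm_sqr; apply: eq_bigr => i _; rewrite !mxE expr2.
  apply: C1_onD; first exact: C1_on_cst.
  apply: C1_onM; first exact: C1_on_cst.
  apply: C1_on_sum => i.
  by apply: C1_onM; apply: C1_onD; [exact: C1_on_coord|exact: C1_on_cst|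
    exact: C1_on_coord|exact: C1_on_cst].
pose sg x := \sum_(y <- s) rho y x.
have sg0 x : omega x -> sg x != 0.
  move=> ox; have [y ys xy] := sP x ox.
  rewrite psumr_neq0; last by move=> *; exact: sqpos_ge0.
  apply/hasP; exists y => //=; rewrite /rho/sqpos exprn_gt0// lt_max subr_gt0.
  rewrite ltr_pXn2r ?nnegrE ?enorm_ge0 ?(ltW e0)// orbC.
  rewrite (le_lt_trans (enorm_le_norm _))//.
  rewrite (@le_lt_trans _ _ (d.+1%:R * `|x - y|))//; first by rewrite ler_wpM2r// ler_nat.
  by rewrite mulrC -ltr_pdivlMr.
have chiC y : C1_on omega (rho y \* (fun x => (sg x)^-1)).
  apply: C1_onM => //; apply: C1_on_inv => //; exact: C1_on_sum.
have [chi chiE] := choice (fun y => C1_of (chiC y)).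
exists s, chi; split => // [y x ox|x ox|y x ox].
- by rewrite chiE//= divr_ge0 ?sqpos_ge0// sumr_ge0// => *; exact: sqpos_ge0.
- under eq_bigr do rewrite chiE//=.
  by rewrite -mulr_suml mulfV// sg0.
rewrite chiE//= mulf_eq0 negb_or => /andP[+ _].
rewrite leNgt; apply: contraNN => exy.
rewrite /rho /sqpos max_l ?expr0n// subr_le0.
by rewrite ler_pXn2r ?nnegrE ?enorm_ge0 ?(ltW e0)// ltW.
Qed.

End partition_of_unity.

(** * Lipschitz continuity of C1 functions on a quasiconvex set *)

Section local_slope.
Context {R : realType}.

(** A mean value inequality for functions that need not be differentiable. The
times up to which the bound holds have a supremum; the local bound at this
supremum shows that it belongs to them and, unless it is 1, can be exceeded. *)
Lemma local_slope_le (f : R -> R) (K : R) :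
  (forall t, 0 <= t <= 1 -> exists2 r, 0 < r & forall s, 0 <= s <= 1 ->
     `|s - t| < r -> `|f s - f t| <= K * `|s - t|) ->
  `|f 1 - f 0| <= K.
Proof.
move=> H.
pose S := [set t | 0 <= t <= 1 /\ `|f t - f 0| <= K * t].
have S0 : S 0 by split; [rewrite lexx ler01|rewrite subrr normr0 mulr0].
have ubS : has_ubound S by exists 1 => t [/andP[]].
have supS : has_sup S by split => //; exists 0.
pose m := sup S.
have m0 : 0 <= m by exact: ub_le_sup.
have m1 : m <= 1 by apply: ge_sup; [exists 0|move=> t [/andP[]]].
have m01 : 0 <= m <= 1 by rewrite m0.
have [r r0 Hr] := H m m01.
have Sm : S m.
  split => //; have [t St mt] := sup_adherent r0 supS.
  have tm : t <= m by exact: ub_le_sup.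
  have [/andP[t0 t1] Ht] := St.
  have tmr : `|t - m| < r by rewrite distrC ger0_norm ?subr_ge0//; rewrite -/m in mt; lra.
  have := Hr t; rewrite t0 t1 => /(_ isT tmr).
  rewrite (distrC t) (ger0_norm (_ : 0 <= m - t)) ?subr_ge0// => Hmt.
  rewrite -[f m](subrK (f t)) -addrA (le_trans (ler_normD _ _))// distrC.
  by rewrite (le_trans (lerD Hmt Ht))// -mulrDr subrK.
have [m1'|m1'] := ltP m 1; last first.
  have <- : m = 1 by apply/eqP; rewrite eq_le m1.
  by have [_] := Sm; rewrite (_ : m = 1) ?mulr1//; apply/eqP; rewrite eq_le m1.
pose s := Num.min 1 (m + r / 2).
have ms : m < s by rewrite lt_min m1' ltrDl divr_gt0.
have s1 : s <= 1 by rewrite ge_min lexx.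
have smr : s <= m + r / 2 by rewrite ge_min lexx orbT.
have s0 : 0 <= s by rewrite (le_trans m0)// ltW.
suff : S s by move=> /(ub_le_sup ubS); rewrite leNgt ms.
split; first by rewrite s0.
have Hs : `|f s - f m| <= K * `|s - m|.
  apply: Hr; first by rewrite s0.
  by rewrite ger0_norm ?subr_ge0 ?(ltW ms)//; lra.
rewrite -[f s](subrK (f m)) -addrA (le_trans (ler_normD _ _))//.
rewrite (le_trans (lerD Hs Sm.2))// -mulrDr ger0_norm ?subr_ge0 ?(ltW ms)//.
by rewrite subrK.
Qed.

End local_slope.

Section C1_lipschitz.
Context {R : realType} {d : nat}.
Variable omega : set 'rV[R]_d.
Hypothesis co : compact omega.
Implicit Types phi : C1 omega.

Lemma C1_norm_ge0 phi : 0 <= C1_norm phi.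
Proof.
rewrite /C1_norm le_max; apply/orP; left; rewrite /supnorm.
have [A0|/set0P[_ [x ox _]]] := eqVneq [set `|phi x| | x in omega] set0.
  by rewrite A0 sup0.
apply: (le_trans (normr_ge0 (phi x))).
apply: ub_le_sup; last by exists x.
have [_ cphi _ _] := C1P phi.
have [M [_ bM]] := continuous_bounded co cphi.
by exists (M + 1) => _ [y oy <-]; apply: bM => //; rewrite ltrDl.
Qed.

Lemma enorm_gradient_le phi x : omega x -> enorm (C1_gradient phi x) <= C1_norm phi.
Proof.
move=> ox; rewrite /C1_norm le_max; apply/orP; right.
apply: (le_trans (ler_norm _)).
apply: ub_le_sup; last by exists x.
have [cg _] := svalP (cid (C1_gradient_exists phi)).
have ceg : {within omega, continuous (enorm \o C1_gradient phi)}.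
  by move=> y; apply: (@cvg_comp _ _ _ (C1_gradient phi) (@enorm R d));
    [exact: cg|exact: enorm_continuous].
have [M [_ bM]] := continuous_bounded co ceg.
by exists (M + 1) => _ [y oy <-]; apply: bM => //; rewrite ltrDl.
Qed.

Lemma C1_diff_le phi x h : omega° x -> `|'d phi x h| <= C1_norm phi * enorm h.
Proof.
move=> ox; rewrite diff_gradient (le_trans (dotp_le_enorm _ _))//.
apply: ler_wpM2r; first exact: enorm_ge0.
have [_ gE] := svalP (cid (C1_gradient_exists phi)).
by rewrite -(gE _ ox); apply: enorm_gradient_le; exact: interior_subset.
Qed.

(** The curve is Lipschitz but possibly not differentiable; hence the chain rule
is replaced by a bound on the local slopes of the composition. *)
Lemma C1_curve_le phi (gam : R -> 'rV[R]_d) L : 0 <= L ->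
  (forall t, t \in `[0, 1] -> omega° (gam t)) ->
  (forall s t, s \in `[0, 1] -> t \in `[0, 1] ->
     enorm (gam s - gam t) <= L * `|s - t|) ->
  `|phi (gam 1) - phi (gam 0)| <= C1_norm phi * L.
Proof.
move=> L0 og Lg; apply/ler_addgt0Pr => e e0.
have L1 : 0 < L + 1 by rewrite ltr_wpDl.
have e'0 : 0 < e / (L + 1) by rewrite divr_gt0.
apply: (@local_slope_le _ (phi \o gam)) => t t01.
have ot : omega° (gam t) by apply: og; rewrite in_itv.
have [_ _ /(_ _ ot) dphi _] := C1P phi.
have /nbhs_ballP[r/= r0 Hr] := differentiable_eps dphi e'0.
exists (r / (L + 1)) => [|s s01 st]; first by rewrite divr_gt0.
have Lst := Lg s t; rewrite !in_itv/= in Lst; have {}Lst := Lst s01 t01.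
have nst := le_trans (norm_le_enorm _) Lst.
have := Hr (gam s - gam t); rewrite -ball_normE/= sub0r normrN subrK.
have -> : `|gam s - gam t| < r.
  rewrite (le_lt_trans nst)//.
  rewrite (@le_lt_trans _ _ ((L + 1) * `|s - t|))//.
    by rewrite ler_wpM2r// lerDl.
  by rewrite mulrC -ltr_pdivlMr.
move=> /(_ isT) Hd.
rewrite -[X in `|X|](subrK ('d phi (gam t) (gam s - gam t))).
rewrite (le_trans (ler_normD _ _))//.
rewrite (le_trans (lerD Hd (C1_diff_le _ _ ot)))//.
rewrite mulrDl addrC lerD//.
  by rewrite -mulrA ler_wpM2l// C1_norm_ge0.
rewrite (le_trans (ler_wpM2l (ltW e'0) nst))// -mulrA ler_wpM2l ?(ltW e0)//.
by rewrite mulrA ler_piMl// ler_pdivrMl// mulr1 lerDl.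
Qed.

(** Two interior points at distance at most [r] are joined by a curve in the
interior of length at most [C] times their distance, and for the other pairs the
bound on the function suffices. Boundary points are reached by continuity. *)
Lemma C1_lipschitz : omega = closure omega° ->
  uniformly_locally_quasiconvex omega° ->
  exists2 K, 0 < K & forall phi x y, omega x -> omega y ->
    `|phi x - phi y| <= K * C1_norm phi * enorm (x - y).
Proof.
move=> oE [r [C [r0 C1 H]]].
have C0 : 0 < C by rewrite (lt_le_trans ltr01).
exists (Num.max C (2 / r)); first by rewrite lt_max C0.
set K := Num.max C (2 / r) => phi.
have N0 : 0 <= C1_norm phi by exact: C1_norm_ge0.
have K0 : 0 <= K by rewrite le_max ltW.
have Hint x y : omega° x -> omega° y ->
    `|phi x - phi y| <= K * C1_norm phi * enorm (x - y).
  move=> ox oy; have [xyr|xyr] := leP (enorm (x - y)) r.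
    have [gam [_ gamo g0 g1 Lg]] := H x y ox oy xyr.
    have L0 : 0 <= C * enorm (x - y) by rewrite mulr_ge0 ?enorm_ge0 ?(ltW C0).
    have := C1_curve_le phi L0 gamo Lg.
    rewrite g0 g1 distrC => /le_trans; apply.
    rewrite mulrA [_ * C]mulrC; apply: ler_wpM2r; first exact: enorm_ge0.
    by apply: ler_wpM2r => //; rewrite le_max lexx.
  have B z : omega° z -> `|phi z| <= C1_norm phi.
    by move=> oz; apply: C1_norm_ge => //; exact: interior_subset.
  rewrite (le_trans (ler_normB _ _))// (le_trans (lerD (B _ ox) (B _ oy)))//.
  rewrite -mulr2n -mulr_natl [K * _]mulrC -mulrA [leLHS]mulrC ler_wpM2l//.
  rewrite (@le_trans _ _ (2 / r * enorm (x - y)))//.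
    by rewrite mulrAC ler_pdivlMr// ler_wpM2l// ltW.
  by rewrite ler_wpM2r ?enorm_ge0// le_max lexx orbT.
move=> x y ox oy.
have [_ cphi _ _] := C1P phi.
have KN0 : 0 <= K * C1_norm phi by rewrite mulr_ge0.
have near_int z e : omega z -> 0 < e ->
    exists z', [/\ omega° z', `|phi z - phi z'| < e & `|z - z'| < e].
  move=> oz e0; have [q q0 Hq] := within_continuous_eps cphi oz e0.
  have : closure omega° z by rewrite -oE.
  have qe0 : 0 < Num.min q e by rewrite lt_min q0.
  move=> /(_ (ball z (Num.min q e))) [].
    exact: nbhsx_ballx.
  move=> z' [oz' zz']; exists z'; move: zz'; rewrite -ball_normE/= lt_min => /andP[zq ze].
  by split => //; apply: Hq => //; exact: interior_subset.
apply/ler_addgt0Pr => e e0.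
pose B := 2 + K * C1_norm phi.
have B0 : 0 < B by rewrite ltr_pwDl.
have e'0 : 0 < e / B by rewrite divr_gt0.
have /cvgrPdist_lt/(_ _ e'0)/nbhs_ballP[q/= q0 Hq] := @enorm_continuous R d (x - y).
have m0 : 0 < Num.min (q / 2) (e / B) by rewrite lt_min e'0 divr_gt0.
have [x' [ox' /ltW px xx']] := near_int x _ ox m0.
have [y' [oy' /ltW py yy']] := near_int y _ oy m0.
move: px py xx' yy'; rewrite !le_min !lt_min.
move=> /andP[_ px] /andP[_ py] /andP[xx' _] /andP[yy' _].
have := Hq (x' - y'); rewrite -ball_normE/=.
have -> : `|x - y - (x' - y')| < q.
  have -> : x - y - (x' - y') = (x - x') - (y - y').
    by rewrite !opprB addrACA [RHS]addrACA; congr (_ + _); rewrite addrC.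
  by rewrite (le_lt_trans (ler_normB _ _))// [q]splitr ltrD.
move=> /(_ isT); rewrite distrC => /ltW/(le_trans (ler_norm _)).
rewrite lerBlDr => Hn.
have := Hint _ _ ox' oy' => Hxy.
have Hxy' : `|phi x' - phi y'| <= K * C1_norm phi * (e / B + enorm (x - y)).
  by rewrite (le_trans Hxy)// ler_wpM2l.
have -> : phi x - phi y = (phi x - phi x') + (phi x' - phi y') - (phi y - phi y') by ring.
rewrite (le_trans (ler_normB _ _))//.
rewrite (@le_trans _ _ (e / B + K * C1_norm phi * (e / B + enorm (x - y)) + e / B))//.
  by rewrite lerD// (le_trans (ler_normD _ _))// lerD.
have -> : e = (e / B) * B by rewrite divfK// gt_eqF.
by rewrite mulfK ?gt_eqF// /B; lra.
Qed.

End C1_lipschitz.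

(** * Integration against signed measures *)

Section bounded_measurable.
Context d (T : measurableType d) (R : realType).
Implicit Types (D : set T) (f g : T -> R) (mu : {measure set T -> \bar R}).

(** Integrability for all finite measures at once. *)
Definition bounded_measurable D f :=
  measurable_fun D f /\ exists M, forall x, D x -> `|f x| <= M.

Lemma bounded_measurable_integrable mu D f : measurable D -> (mu D < +oo)%E ->
  bounded_measurable D f -> mu.-integrable D (EFin \o f).
Proof.
move=> mD Dfin [mf [M fM]]; apply: measurable_bounded_integrable => //.
exists M; split; first exact: num_real.
by move=> y My x Dx /=; rewrite (le_trans (fM x Dx))// ltW.
Qed.

Lemma bounded_measurable_cst D a : bounded_measurable D (cst a).
Proof. by split; [exact: measurable_cst|exists `|a|]. Qed.

Lemma bounded_measurableD D f g : bounded_measurable D f ->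
  bounded_measurable D g -> bounded_measurable D (fun x => f x + g x).
Proof.
move=> [mf [M fM]] [mg [N gN]]; split; first exact: measurable_funD.
by exists (M + N) => x Dx; rewrite (le_trans (ler_normD _ _))// lerD// ?fM ?gN.
Qed.

Lemma bounded_measurableZ D f a : bounded_measurable D f ->
  bounded_measurable D (fun x => a * f x).
Proof.
move=> [mf [M fM]]; split; first exact: measurable_funM.
by exists (`|a| * M) => x Dx; rewrite normrM ler_wpM2l// fM.
Qed.

Lemma bounded_measurableB D f g : bounded_measurable D f ->
  bounded_measurable D g -> bounded_measurable D (fun x => f x - g x).
Proof.
move=> bf /(bounded_measurableZ (-1)) bg.
have -> : (fun x => f x - g x) = (fun x => f x + -1 * g x).
  by apply/funext => x; rewrite mulN1r.
exact: bounded_measurableD.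
Qed.

End bounded_measurable.

Section signed_integral.

Let fine_num_subK (R : realType) (a b p n : \bar R) :
  a \is a fin_num -> b \is a fin_num -> p \is a fin_num -> n \is a fin_num ->
  (p - n = a - b -> a + n = p + b)%E.
Proof.
move: a b p n => [a||] [b||] [p||] [n||]// _ _ _ _ [] pn; congr EFin.
by rewrite addrC -[p](subrK n) pn; ring.
Qed.

Let fine_num_subBDA (R : realType) (a b p n : \bar R) :
  a \is a fin_num -> b \is a fin_num -> p \is a fin_num -> n \is a fin_num ->
  ((a - b) - (p - n) = (a + n) - (b + p))%E.
Proof.
move: a b p n => [a||] [b||] [p||] [n||]// _ _ _ _; congr EFin; ring.
Qed.

Context d (T : measurableType d) (R : realType).
Implicit Types (D : set T) (f : T -> R) (mu : {measure set T -> \bar R}).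
Implicit Types nu : {charge set T -> \bar R}.

Lemma Rintegral_measure_add mu1 mu2 D f : measurable D ->
  (mu1 D < +oo)%E -> (mu2 D < +oo)%E -> bounded_measurable D f ->
  \int[measure_add mu1 mu2]_(x in D) f x =
  \int[mu1]_(x in D) f x + \int[mu2]_(x in D) f x.
Proof.
move=> mD D1 D2 bf.
have i1 := bounded_measurable_integrable mD D1 bf.
have i2 := bounded_measurable_integrable mD D2 bf.
rewrite /Rintegral integral_measure_add//.
by rewrite fineD//; exact: integrable_fin_num.
Qed.

(** If [mu1 - mu2] equals the Jordan decomposition [P - N], then [mu1 + N] and
[P + mu2] are the same measure. This makes the signed integral additive in the
measure and computable on nonnegative measures. *)
Lemma cintegral_diff nu mu1 mu2 D f : measurable D ->
  (mu1 setT < +oo)%E -> (mu2 setT < +oo)%E ->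
  (forall A, measurable A -> nu A = (mu1 A - mu2 A)%E) ->
  bounded_measurable D f ->
  cintegral nu D f = \int[mu1]_(x in D) f x - \int[mu2]_(x in D) f x.
Proof.
move=> mD f1 f2 nuE bf; rewrite /cintegral.
set P := jordan_pos _; set N := jordan_neg _.
have fin (m : {measure set T -> \bar R}) A : measurable A ->
    (m setT < +oo)%E -> m A \is a fin_num.
  move=> mA mfin; rewrite ge0_fin_numE//; apply: le_lt_trans mfin.
  by apply: le_measure; rewrite ?inE.
have finA (m : {measure set T -> \bar R}) A : measurable A ->
    (m setT < +oo)%E -> (m A < +oo)%E.
  by move=> mA mfin; rewrite ltey_eq fin.
have fP : (P setT < +oo)%E by rewrite ltey_eq fin_num_measure.
have fN : (N setT < +oo)%E by rewrite ltey_eq fin_num_measure.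
suff : \int[mu1]_(x in D) f x + \int[N]_(x in D) f x =
       \int[P]_(x in D) f x + \int[mu2]_(x in D) f x by lra.
rewrite -!Rintegral_measure_add//; try exact: finA.
rewrite /Rintegral; congr fine; apply: eq_measure_integral => A mA _.
rewrite -[LHS]/(measure_add mu1 N A) -[RHS]/(measure_add P mu2 A) !measure_addE.
apply: fine_num_subK; rewrite ?fin//.
rewrite -(nuE A mA) (jordan_decomp (hahn_posneg nu) mA).
by rewrite /cadd /= cscaleN1.
Qed.

Lemma cintegral_measure nu mu D f : measurable D -> (mu setT < +oo)%E ->
  (forall A, measurable A -> nu A = mu A) -> bounded_measurable D f ->
  cintegral nu D f = \int[mu]_(x in D) f x.
Proof.
move=> mD mufin numu bf; rewrite (@cintegral_diff _ mu mzero)//.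
- by rewrite /Rintegral integral_measure_zero subr0.
- by rewrite /mzero/= ltry.
- by move=> A mA; rewrite /mzero/= sube0 numu.
Qed.

Let measure_add_lty mu1 mu2 : (mu1 setT < +oo)%E -> (mu2 setT < +oo)%E ->
  (measure_add mu1 mu2 setT < +oo)%E.
Proof. by rewrite measure_addE; exact: lte_add_pinfty. Qed.

Lemma cintegralB (nu1 nu2 : {charge set T -> \bar R}) D f : measurable D ->
  bounded_measurable D f ->
  cintegral (cadd nu1 (copp nu2)) D f = cintegral nu1 D f - cintegral nu2 D f.
Proof.
move=> mD bf; rewrite [in RHS]/cintegral.
set P1 := jordan_pos (hahn_posneg nu1); set N1 := jordan_neg (hahn_posneg nu1).
set P2 := jordan_pos (hahn_posneg nu2); set N2 := jordan_neg (hahn_posneg nu2).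
have fin (m : {finite_measure set T -> \bar R}) A : measurable A -> (m A < +oo)%E.
  by move=> mA; rewrite ltey_eq fin_num_measure.
rewrite (@cintegral_diff _ (measure_add P1 N2) (measure_add N1 P2))//.
- by rewrite !Rintegral_measure_add//; try exact: fin; ring.
- by apply: measure_add_lty; exact: fin.
- by apply: measure_add_lty; exact: fin.
move=> A mA; transitivity ((P1 A + N2 A) - (N1 A + P2 A))%E; last first.
  by congr (_ - _)%E; exact: esym (measure_addE _ _ _).
rewrite -[LHS]/(nu1 A - nu2 A)%E.
rewrite (jordan_decomp (hahn_posneg nu1) mA) (jordan_decomp (hahn_posneg nu2) mA).
rewrite /cadd/= !cscaleN1.
have F (m : {finite_measure set T -> \bar R}) := fin_num_measure m A mA.
exact: fine_num_subBDA (F P1) (F N1) (F P2) (F N2).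
Qed.

Lemma cintegral_bound nu D : measurable D ->
  exists2 V, 0 <= V & forall f B, bounded_measurable D f ->
    (forall x, D x -> `|f x| <= B) -> `|cintegral nu D f| <= V * B.
Proof.
move=> mD; rewrite /cintegral; set P := jordan_pos _; set N := jordan_neg _.
exists (fine (P D) + fine (N D)) => [|f B bf fB].
  by rewrite addr_ge0// fine_ge0.
have K (m : {finite_measure set T -> \bar R}) : `|\int[m]_(x in D) f x| <= fine (m D) * B.
  have mfin : (m D < +oo)%E by rewrite ltey_eq fin_num_measure.
  have fi := bounded_measurable_integrable mD mfin bf.
  rewrite (le_trans (le_normr_Rintegral _ _))// mulrC -Rintegral_cst//.
  apply: le_Rintegral => //; first exact: integrable_norm.
  exact: (bounded_measurable_integrable mD mfin (bounded_measurable_cst D B)).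
by rewrite mulrDl (le_trans (ler_normB _ _))// lerD//; exact: K.
Qed.

End signed_integral.

Section signed_integral_linear.
Context d (T : measurableType d) (R : realType).
Variables (nu : {charge set T -> \bar R}) (D : set T).
Hypothesis mD : measurable D.

Let fin (m : {finite_measure set T -> \bar R}) : (m D < +oo)%E.
Proof. by rewrite ltey_eq fin_num_measure. Qed.

Lemma cintegralZ (f : T -> R) a : bounded_measurable D f ->
  cintegral nu D (fun x => a * f x) = a * cintegral nu D f.
Proof.
move=> bf; rewrite /cintegral !RintegralZl//; first by rewrite mulrBr.
- exact: (bounded_measurable_integrable mD (fin _) bf).
- exact: (bounded_measurable_integrable mD (fin _) bf).
Qed.

Lemma cintegralBr (f g : T -> R) : bounded_measurable D f -> bounded_measurable D g ->
  cintegral nu D (fun x => f x - g x) = cintegral nu D f - cintegral nu D g.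
Proof.
move=> bf bg; rewrite /cintegral !RintegralB//; first by ring.
- exact: (bounded_measurable_integrable mD (fin _) bf).
- exact: (bounded_measurable_integrable mD (fin _) bg).
- exact: (bounded_measurable_integrable mD (fin _) bf).
- exact: (bounded_measurable_integrable mD (fin _) bg).
Qed.

End signed_integral_linear.

(** * The bounded Lipschitz norm *)

Section bounded_lipschitz.
Context {R : realType} {d : nat}.
Variable omega : set 'rV[R]_d.
Hypothesis co : compact omega.
Implicit Types (f : 'rV[R]_d -> R) (nu : {charge set (borelRd R d) -> \bar R}).

Let mo : measurable (omega : set (borelRd R d)) := compact_measurable_borel co.

Lemma continuous_bounded_measurable f : {within omega, continuous f} ->
  bounded_measurable (omega : set (borelRd R d)) f.
Proof.
move=> cf; split; first exact: continuous_measurable_borel.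
have [M [_ bM]] := continuous_bounded co cf.
by exists (M + 1) => x ox; apply: bM => //; rewrite ltrDl.
Qed.

Lemma lipschitz_within_continuous f L : 0 <= L ->
  (forall x y, omega x -> omega y -> `|f x - f y| <= L * enorm (x - y)) ->
  {within omega, continuous f}.
Proof.
move=> L0 H; apply: eps_within_continuous => x e ox e0.
have B0 : 0 < L * d%:R + 1 by rewrite ltr_wpDl// mulr_ge0.
exists (e / (L * d%:R + 1)) => [|y oy xy]; first by rewrite divr_gt0.
rewrite (le_lt_trans (H _ _ ox oy))//.
rewrite (le_lt_trans (ler_wpM2l L0 (enorm_le_norm _)))// mulrA.
rewrite (@le_lt_trans _ _ ((L * d%:R + 1) * `|x - y|))//.
  by rewrite ler_wpM2r// lerDl.
by rewrite mulrC -ltr_pdivlMr.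
Qed.

Definition BL_test f := (forall x, omega x -> `|f x| <= 1) /\
  (forall x y, omega x -> omega y -> `|f x - f y| <= enorm (x - y)).

Lemma BL_test_continuous f : BL_test f -> {within omega, continuous f}.
Proof.
move=> [_ H]; apply: (@lipschitz_within_continuous _ 1) => // x y ox oy.
by rewrite mul1r H.
Qed.

Lemma BL_test_bounded_measurable f : BL_test f ->
  bounded_measurable (omega : set (borelRd R d)) f.
Proof. by move/BL_test_continuous/continuous_bounded_measurable. Qed.

Lemma BL_testN f : BL_test f -> BL_test (fun x => -1 * f x).
Proof.
move=> [f1 fL]; split => [x ox|x y ox oy]; first by rewrite mulN1r normrN f1.
by rewrite -mulrBr mulN1r normrN fL.
Qed.

(** Replaces the bounds on [supnorm] and [Lip] by inequalities between values. *)
Lemma BL_testP f : BL_test f <->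
  {within omega, continuous f} /\ (maxe (supnorm omega f)%:E (Lip omega f) <= 1)%E.
Proof.
split => [bf|[cf]].
  split; first exact: BL_test_continuous.
  have [f1 fL] := bf; rewrite ge_max; apply/andP; split.
    rewrite lee_fin /supnorm.
    have [A0|/set0P A0] := eqVneq [set `|f x| | x in omega] set0.
      by rewrite A0 sup0.
    by apply: ge_sup => // _ [x ox <-]; exact: f1.
  apply: ereal_inf_lbound; exists 1 => //; split => // x y ox oy.
  by rewrite mul1r fL.
rewrite ge_max => /andP[s1 L1]; split => [x ox|x y ox oy].
  rewrite lee_fin in s1; apply: le_trans s1.
  apply: ub_le_sup; last by exists x.
  have [M [_ bM]] := continuous_bounded co cf.
  by exists (M + 1) => _ [y oy <-]; apply: bM => //; rewrite ltrDl.
rewrite leNgt; apply/negP => qn.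
have n0 : 0 <= enorm (x - y) by exact: enorm_ge0.
suff [a a1 aL] : exists2 a : R, 1 < a & (a%:E <= Lip omega f)%E.
  by have := le_trans aL L1; rewrite lee_fin leNgt a1.
have [n00|n00] := eqVneq (enorm (x - y)) 0.
  (* No constant is admissible here, so that any number is a lower bound. *)
  exists 2; first by rewrite ltr1n.
  apply: le_ereal_inf_tmp => _ [L [L0 H] <-]; have := H x y ox oy.
  by rewrite n00 mulr0 leNgt -n00 qn.
have n1 : 0 < enorm (x - y) by rewrite lt_def n00.
exists (`|f x - f y| / enorm (x - y)); first by rewrite ltr_pdivlMr// mul1r.
apply: le_ereal_inf_tmp => _ [L [L0 H] <-]; have := H x y ox oy.
by rewrite lee_fin ler_pdivrMr.
Qed.

Lemma BL_norm_ge nu f : BL_test f -> cintegral nu omega f <= BL_norm omega nu.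
Proof.
move=> bf; apply: ub_le_sup; last by exists f => //; exact/BL_testP.
have [V V0 HV] := cintegral_bound nu mo.
exists (V * 1) => _ [g /BL_testP bg <-].
apply: (le_trans (ler_norm _)); apply: HV; first exact: BL_test_bounded_measurable.
by case: bg.
Qed.

Lemma BL_norm_le nu b : (forall f, BL_test f -> cintegral nu omega f <= b) ->
  BL_norm omega nu <= b.
Proof.
move=> H; apply: ge_sup => [|_ [f /BL_testP bf <-]]; last exact: H.
exists (cintegral nu omega (fun=> 0)), (fun=> 0) => //; apply/BL_testP.
split => [x _|x y _ _]; rewrite ?subrr ?normr0//; exact: enorm_ge0.
Qed.

Lemma BL_norm_ge0 nu : 0 <= BL_norm omega nu.
Proof.
have H : BL_test (fun=> 0).
  by split => [x _|x y _ _]; rewrite ?subrr ?normr0//; exact: enorm_ge0.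
apply: le_trans (BL_norm_ge nu H).
rewrite /cintegral [X in X - _](_ : _ = 0) ?[X in _ - X](_ : _ = 0) ?subr0//.
  by rewrite /Rintegral integral0.
by rewrite /Rintegral integral0.
Qed.

Lemma BL_norm_scaled nu f N : 0 < N -> (forall x, omega x -> `|f x| <= N) ->
  (forall x y, omega x -> omega y -> `|f x - f y| <= N * enorm (x - y)) ->
  `|cintegral nu omega f| <= N * BL_norm omega nu.
Proof.
move=> N0 fN fL.
have bf : bounded_measurable (omega : set (borelRd R d)) f.
  apply: continuous_bounded_measurable.
  exact: (lipschitz_within_continuous (ltW N0) fL).
have bt : BL_test (fun x => N^-1 * f x).
  split => [x ox|x y ox oy]; first by rewrite normrM gtr0_norm ?invr_gt0// ler_pdivrMl// mulr1 fN.
  by rewrite -mulrBr normrM gtr0_norm ?invr_gt0// ler_pdivrMl// fL.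
have H1 := BL_norm_ge nu bt; have H2 := BL_norm_ge nu (BL_testN bt).
rewrite cintegralZ// in H1.
rewrite cintegralZ// in H2; last exact: bounded_measurableZ.
rewrite cintegralZ// mulN1r in H2.
by rewrite -ler_pdivrMl// -[N^-1]gtr0_norm ?invr_gt0// -normrM ler_norml lerNl H1 H2.
Qed.

Lemma C1_continuous (phi : C1 omega) : {within omega, continuous phi}.
Proof. by have [] := C1P phi. Qed.

(** By its Lipschitz estimate, a C1 function is a test function up to a multiple of
its norm. *)
Lemma Pi_le_BL_norm (K : R) : (forall (phi : C1 omega) x y, omega x -> omega y ->
    `|phi x - phi y| <= K * C1_norm phi * enorm (x - y)) ->
  forall nu (phi : C1 omega), `|cintegral nu omega phi| <=
    Num.max 1 K * C1_norm phi * BL_norm omega nu.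
Proof.
move=> HK nu phi; set N := Num.max 1 K * C1_norm phi.
have N0 : 0 <= C1_norm phi by exact: C1_norm_ge0.
have K1 : 1 <= Num.max 1 K by rewrite le_max lexx.
have N1 : C1_norm phi <= N by rewrite ler_peMl.
apply/ler_addgt0Pr => e e0.
have B0 := BL_norm_ge0 nu.
have B1 : 0 < BL_norm omega nu + 1 by rewrite ltr_wpDl.
have e'0 : 0 < e / (BL_norm omega nu + 1) by rewrite divr_gt0.
(* The scaling factor must stay positive when the norm of [phi] is 0. *)
have Np : 0 < N + e / (BL_norm omega nu + 1).
  by rewrite ltr_wpDl// (le_trans N0).
have := @BL_norm_scaled nu phi _ Np; rewrite mulrDl => H.
apply: le_trans (H _ _) _.
- move=> x ox; apply: (le_trans (C1_norm_ge phi co ox)).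
  by rewrite (le_trans N1)// lerDl ltW.
- move=> x y ox oy; apply: (le_trans (HK phi x y ox oy)).
  apply: ler_wpM2r; first exact: enorm_ge0.
  apply: (@le_trans _ _ N); last by rewrite lerDl ltW.
  by rewrite ler_wpM2r// le_max lexx orbT.
rewrite lerD2l mulrAC ler_pdivrMr// ler_wpM2l ?(ltW e0)//.
by rewrite lerDl.
Qed.

End bounded_lipschitz.

(** * Measures are determined by their integrals against C1 functions *)

Section C1_density.
Context {R : realType} {d : nat}.
Variable omega : set 'rV[R]_d.
Hypothesis co : compact omega.
Implicit Types (f : 'rV[R]_d -> R) (nu : {charge set (borelRd R d) -> \bar R}).

Let mo : measurable (omega : set (borelRd R d)) := compact_measurable_borel co.

Lemma C1_sumE (s : seq 'rV[R]_d) (a : 'rV[R]_d -> R) (chi : 'rV[R]_d -> C1 omega) x :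
  (\sum_(y <- s) a y *: chi y : C1 omega) x = \sum_(y <- s) a y * chi y x.
Proof. by elim: s => [|y s IH]; rewrite ?big_nil// !big_cons -IH. Qed.

Lemma C1_dualP (xi : C1_dual omega) a (phi psi : C1 omega) :
  xi (a *: phi + psi) = a * xi phi + xi psi.
Proof. by have /asboolP[] := C1_dual_funP xi. Qed.

Lemma C1_dual_sumE (xi : C1_dual omega) (s : seq 'rV[R]_d) (a : 'rV[R]_d -> R)
    (chi : 'rV[R]_d -> C1 omega) :
  xi (\sum_(y <- s) a y *: chi y) = \sum_(y <- s) a y * xi (chi y).
Proof.
elim: s => [|y s IH]; last by rewrite !big_cons C1_dualP IH.
rewrite !big_nil; have := C1_dualP xi (-1) 0 0.
by rewrite scaler0 addr0 => /eqP; rewrite mulN1r addNr => /eqP.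
Qed.

(** The partition of unity averages the values of [f] at points within distance [r],
so that the error is the oscillation of [f] at this scale. *)
Lemma partition_approx (s : seq 'rV[R]_d) (chi : 'rV[R]_d -> C1 omega) f r e x :
  (forall y x, omega x -> 0 <= chi y x) ->
  (forall x, omega x -> \sum_(y <- s) chi y x = 1) ->
  (forall y x, omega x -> chi y x != 0 -> enorm (x - y) <= r) ->
  (forall y, y \in s -> enorm (x - y) <= r -> `|f x - f y| <= e) -> omega x ->
  `|f x - (\sum_(y <- s) f y *: chi y : C1 omega) x| <= e.
Proof.
move=> chi0 chi1 chir fe ox; rewrite C1_sumE.
have -> : f x = \sum_(y <- s) f x * chi y x by rewrite -mulr_sumr chi1// mulr1.
rewrite -sumrB (le_trans (ler_norm_sum _ _ _))//.
have -> : e = \sum_(y <- s) e * chi y x by rewrite -mulr_sumr chi1// mulr1.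
rewrite big_seq [leRHS]big_seq; apply: ler_sum => y ys.
rewrite -mulrBl normrM (ger0_norm (chi0 y x ox)).
have [->|c0] := eqVneq (chi y x) 0; first by rewrite !mulr0.
by apply: ler_wpM2r; [exact: chi0|apply: fe => //; exact: chir].
Qed.

Lemma C1_dense f e : {within omega, continuous f} -> 0 < e ->
  exists g : C1 omega, forall x, omega x -> `|f x - g x| <= e.
Proof.
move=> cf e0; have [r r0 Hr] := compact_uniform_continuous co cf e0.
have r20 : 0 < r / 2 by rewrite divr_gt0.
have [s [chi [so chi0 chi1 chir]]] := C1_partition_of_unity co r20.
exists (\sum_(y <- s) f y *: chi y) => x ox.
apply: (partition_approx chi0 chi1 chir) => // y ys xy.
apply/ltW/Hr => //; first exact: so.
rewrite (le_lt_trans (norm_le_enorm _))// (le_lt_trans xy)//; lra.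
Qed.

Lemma cintegral_eq0_dense nu :
  (forall phi : C1 omega, cintegral nu omega phi = 0) ->
  forall f, {within omega, continuous f} -> cintegral nu omega f = 0.
Proof.
move=> H f cf; have [V V0 HV] := cintegral_bound nu mo.
apply/eqP; rewrite -normr_eq0 eq_le normr_ge0 andbT.
apply/ler_addgt0Pr => e e0; rewrite add0r.
have V1 : 0 < V + 1 by rewrite ltr_wpDl.
have [g gE] := C1_dense cf (divr_gt0 e0 V1).
have bf := continuous_bounded_measurable co cf.
have bg := continuous_bounded_measurable co (@C1_continuous _ _ _ g).
rewrite -[cintegral _ _ _]subr0 -(H g) -cintegralBr//.
apply: le_trans (HV _ (e / (V + 1)) _ _) _ => //.
  exact: bounded_measurableB.
by rewrite mulrA ler_pdivrMr// mulrC ler_wpM2l ?(ltW e0)// lerDl.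
Qed.

End C1_density.

Section distance.
Context {R : realType} {V : normedModType R}.
Variable U : set V.

(** The distance to the complement of [U], cut off at 1 so that it makes sense
for [U = setT]. *)
Definition codist (x : V) : R :=
  inf [set r | r = 1 \/ exists2 y, ~ U y & r = `|x - y|].

Let lb0 x : has_lbound [set r | r = 1 \/ exists2 y, ~ U y & r = `|x - y| :> R].
Proof. by exists 0 => _ [->//|[y _ ->]]. Qed.

Lemma codist_ge0 x : 0 <= codist x.
Proof. by apply: lb_le_inf; [exists 1; left|move=> _ [->//|[y _ ->]]]. Qed.

Lemma codist_out x : ~ U x -> codist x = 0.
Proof.
move=> Ux; apply/eqP; rewrite eq_le codist_ge0 andbT.
by apply: ge_inf => //; right; exists x => //; rewrite subrr normr0.
Qed.

Lemma codist_gt0 x : open U -> U x -> 0 < codist x.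
Proof.
move=> oU Ux; have /nbhs_ballP[r/= r0 rU] : nbhs x U by exact: open_nbhs_nbhs.
apply: (@lt_le_trans _ _ (Num.min 1 r)); first by rewrite lt_min ltr01.
apply: lb_le_inf; first by exists 1; left.
move=> _ [->|[y Uy ->]]; first by rewrite ge_min lexx.
rewrite ge_min; apply/orP; right; rewrite leNgt; apply/negP => xy.
by apply/Uy/rU; rewrite -ball_normE.
Qed.

Lemma codist_lip x y : `|codist x - codist y| <= `|x - y|.
Proof.
have H a b : codist a - `|a - b| <= codist b.
  apply: lb_le_inf; first by exists 1; left.
  move=> _ [->|[z Uz ->]].
    by rewrite (@le_trans _ _ (codist a))// ?lerBlDr ?lerDl//; apply: ge_inf => //; left.
  rewrite lerBlDr addrC (@le_trans _ _ `|a - z|)//.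
    by apply: ge_inf => //; right; exists z.
  have -> : a - z = (a - b) + (b - z) by rewrite addrA subrK.
  exact: ler_normD.
rewrite ler_norml lerNl opprB !lerBlDl; apply/andP; split.
  by have := H y x; rewrite lerBlDr distrC.
by have := H x y; rewrite lerBlDr.
Qed.

End distance.

Section Pi_injective.
Context {R : realType} {d : nat}.
Variable omega : set 'rV[R]_d.
Hypothesis co : compact omega.
Implicit Types (f : 'rV[R]_d -> R) (nu : {charge set (borelRd R d) -> \bar R}).

Let mo : measurable (omega : set (borelRd R d)) := compact_measurable_borel co.

Let bump (U : set 'rV[R]_d) n (x : 'rV[R]_d) : R := Num.min 1 (n%:R * codist U x).

Let bump_continuous U n : {within omega, continuous (bump U n)}.
Proof.
apply: (@lipschitz_within_continuous _ _ _ _ n%:R) => // x y _ _.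
have H (a b : R) : `|Num.min 1 a - Num.min 1 b| <= `|a - b|.
  by have [a1|a1] := leP 1 a; have [b1|b1] := leP 1 b;
    rewrite ler_norml; apply/andP; split; have := ler_norm (a - b);
    have := ler_norm (- (a - b)); rewrite normrN; lra.
rewrite (le_trans (H _ _))// -mulrBr normrM ger0_norm// ler_wpM2l//.
by rewrite (le_trans (codist_lip _ _ _))// norm_le_enorm.
Qed.

(** The bumps increase to the indicator of [U]. *)
Let bump_cvg U (m : {finite_measure set (borelRd R d) -> \bar R}) : open U ->
  \int[m]_(x in omega) bump U n x @[n --> \oo] --> fine (m (U `&` omega)).
Proof.
move=> oU; have mU : measurable (U : set (borelRd R d)) by exact: sub_sigma_algebra.
have mfin : (m omega < +oo)%E by rewrite ltey_eq fin_num_measure.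
have bb n := continuous_bounded_measurable co (@bump_continuous U n).
have [] := @dominated_convergence _ _ _ m omega mo
  (fun n => EFin \o bump U n) (EFin \o \1_U) (cst 1%E).
- by move=> n; apply/measurable_EFinP; have [] := bb n.
- by apply/measurable_EFinP; exact: measurable_indic.
- apply: aeW => x ox /=; apply: cvg_EFin; first exact: nearW.
  have [Ux|Ux] := pselect (U x); last first.
    have -> : fine \o (fun n : nat => (bump U n x)%:E) = cst (\1_U x).
      by apply/funext => n /=; rewrite /bump codist_out// mulr0 min_r ?ler01// indicE memNset.
    exact: cvg_cst.
  have -> : \1_U x = 1 :> R by rewrite indicE mem_set.
  apply: cvg_near_cst; near=> n; rewrite /= /bump min_l//.
  rewrite -ler_pdivrMr ?codist_gt0// div1r.
  near: n; exact: nbhs_infty_ger.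
- exact: finite_measure_integrable_cst.
- apply: aeW => x n ox /=; rewrite lee_fin /bump ger0_norm ?ge_min ?lexx//.
  by rewrite le_min ler01 mulr_ge0// codist_ge0.
move=> _ _; rewrite integral_indic// -[X in _ --> X]fineK; last first.
  by rewrite fin_num_measure//; exact: measurableI.
by move/fine_cvgP => [_].
Unshelve. all: by end_near. Qed.

(** C1 functions determine the integrals of continuous functions by density, these
determine the measures of open sets as limits of integrals of bumps, and the open
sets form a pi-system that generates the Borel sets. *)
Lemma charge_eq0 nu : (forall phi : C1 omega, cintegral nu omega phi = 0) ->
  forall A : set (borelRd R d), measurable A -> nu (A `&` omega) = 0%E.
Proof.
move=> /(cintegral_eq0_dense co) H.
set P := jordan_pos (hahn_posneg nu); set N := jordan_neg (hahn_posneg nu).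
have PN U : open U -> P (U `&` omega) = N (U `&` omega).
  move=> oU; have mU : measurable (U : set (borelRd R d)) by exact: sub_sigma_algebra.
  have mUo : measurable (U `&` omega : set (borelRd R d)) by exact: measurableI.
  rewrite -[LHS]fineK ?fin_num_measure// -[RHS]fineK ?fin_num_measure//; congr EFin.
  rewrite -(cvg_lim (@norm_hausdorff _ _) (@bump_cvg U P oU)).
  rewrite -(cvg_lim (@norm_hausdorff _ _) (@bump_cvg U N oU)).
  congr (lim (_ @ \oo)); apply/funext => n; apply/eqP; rewrite -subr_eq0; apply/eqP.
  exact: H (@bump_continuous U n).
have mPN A : measurable A -> mrestr P mo A = mrestr N mo A.
  move=> mA; apply: (@measure_unique _ R (borelRd R d) (@open 'rV[R]_d) (fun=> setT)) => //.
  - exact: openI.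
  - by move=> _; exact: openT.
  - by apply/seteqP; split => // x _; exists 0%N.
  - by move=> _; rewrite /= /mrestr ltey_eq fin_num_measure// setTI.
move=> A mA; have mAo : measurable (A `&` omega) by exact: measurableI.
transitivity (P (A `&` omega) - N (A `&` omega))%E.
  by rewrite (jordan_decomp (hahn_posneg nu) mAo) /cadd/= cscaleN1.
have := mPN A mA; rewrite /mrestr => ->; rewrite subee//.
exact: fin_num_measure.
Qed.

Let fin_num_sub_eq0 (a b : \bar R) : a \is a fin_num -> b \is a fin_num ->
  (a - b = 0 -> a = b)%E.
Proof.
by move: a b => [a||] [b||]// _ _ [] ab; congr EFin; apply/eqP; rewrite -subr_eq0 ab.
Qed.

(** [dual_transport_cost] is defined through an arbitrary measure that represents
the functional; this is why the choice does not matter. *)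
Lemma Pi_inj (u v : signed_measure omega) : Pi co u = Pi co v ->
  forall A : set (borelRd R d), measurable A -> u A = v A.
Proof.
move=> uv A mA.
have H0 : forall phi : C1 omega, cintegral (cadd u (copp v)) omega phi = 0.
  move=> phi; rewrite cintegralB//; last first.
    exact: (continuous_bounded_measurable co (@C1_continuous _ _ _ phi)).
  have := congr1 (fun xi : C1_dual omega => xi phi) uv.
  by rewrite /= => ->; rewrite subrr.
have mAo : measurable (A `&` omega : set (borelRd R d)) by exact: measurableI.
have K (w : signed_measure omega) : w A = w (A `&` omega).
  have mAD : measurable (A `\` omega : set (borelRd R d)) by exact: measurableD.
  rewrite -{1}(setUIDK A omega) chargeU//; last first.
    - by apply/seteqP; split => x // [[_ ox] [_]].
  rewrite [X in (_ + X)%E](_ : _ = 0%E) ?adde0//.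
  by apply: (@signed_chargeP _ _ _ w) => //; rewrite setIC setDE setICA setICr setI0.
rewrite !K; apply: fin_num_sub_eq0; [exact: fin_num_measure|exact: fin_num_measure|].
exact: (charge_eq0 H0 mA).
Qed.

End Pi_injective.

(** * Couplings and measurability of the cost *)

Section couplings.
Context {R : realType} {d : nat}.
Variables omega0 omega1 : set 'rV[R]_d.
Hypotheses (co0 : compact omega0) (co1 : compact omega1).
Variable u0 : {finite_measure set (borelRd R d) -> \bar R}.
Hypothesis u0_concentrated : concentrated omega0 u0.
Implicit Types (u : signed_measure omega1).
Implicit Types (pi : {measure set (borelRd R d * borelRd R d) -> \bar R}).

Let mo0 : measurable (omega0 : set (borelRd R d)) := compact_measurable_borel co0.
Let mo1 : measurable (omega1 : set (borelRd R d)) := compact_measurable_borel co1.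

Notation P := ((omega0 `*` omega1) : set (borelRd R d * borelRd R d)).

Lemma measurable_product : measurable P.
Proof. exact: measurableX. Qed.

Lemma bounded_measurable_fst (g : borelRd R d -> R) :
  bounded_measurable (omega0 : set (borelRd R d)) g -> bounded_measurable P (fun z => g z.1).
Proof.
move=> [mg [M gM]]; split; last by exists M => -[x y] /= [ox _]; exact: gM.
apply: (measurable_comp mo0 _ mg); last exact: measurable_funTS.
by move=> _ [[x y] [ox _] <-].
Qed.

Lemma bounded_measurable_snd (g : borelRd R d -> R) :
  bounded_measurable (omega1 : set (borelRd R d)) g -> bounded_measurable P (fun z => g z.2).
Proof.
move=> [mg [M gM]]; split; last by exists M => -[x y] /= [_ oy]; exact: gM.
apply: (measurable_comp mo1 _ mg); last exact: measurable_funTS.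
by move=> _ [[x y] [_ oy] <-].
Qed.

Section marginal.
Variables (pi : {measure set (borelRd R d * borelRd R d) -> \bar R}).
Hypothesis pi_fin : (pi setT < +oo)%E.

Let fin A : measurable A -> (pi A < +oo)%E.
Proof. by move=> mA; apply: le_lt_trans pi_fin; apply: le_measure; rewrite ?inE. Qed.

(** The preimage of [D] may be larger than the product [P], but only by a null set. *)
Lemma marginal_Rintegral (phi : borelRd R d * borelRd R d -> borelRd R d)
    (m : {measure set (borelRd R d) -> \bar R}) (D : set (borelRd R d))
    (g : borelRd R d -> R) :
  measurable_fun setT phi -> measurable D -> bounded_measurable D g ->
  (forall A, measurable A -> m A = pi (phi @^-1` A)) ->
  P `<=` phi @^-1` D -> pi (phi @^-1` D `\` P) = 0%E ->
  \int[m]_(x in D) g x = \int[pi]_(z in P) g (phi z).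
Proof.
move=> mphi mD [mg [M gM]] mE PD PN.
have mphiD : measurable (phi @^-1` D) by rewrite -[X in measurable X]setTI; exact: mphi.
have mg' : measurable_fun setT (g \_ D) by apply/(measurable_restrictT _ mD).
have bg' : bounded_measurable (phi @^-1` D) ((g \_ D) \o phi).
  split; last by exists M => z /= Dz; rewrite patchE mem_set//; exact: gM.
  exact: measurable_funTS (measurableT_comp mg' mphi).
have ig' : pi.-integrable (phi @^-1` D) ((EFin \o (g \_ D)) \o phi).
  by apply: bounded_measurable_integrable bg' => //; exact: fin.
rewrite /Rintegral; congr fine.
transitivity (\int[m]_(x in D) ((g \_ D) x)%:E)%E.
  by apply: eq_integral => x xD; rewrite patchE xD.
transitivity (\int[pushforward pi phi]_(x in D) ((g \_ D) x)%:E)%E.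
  by apply: eq_measure_integral => A mA _; rewrite mE.
rewrite (integral_pushforward mphi _ ig')//; last exact/measurable_EFinP.
rewrite (negligible_integral _ _ ig' PN)//; last first.
  by apply: measurableD => //; exact: measurable_product.
have -> : phi @^-1` D `\` (phi @^-1` D `\` P) = P.
  by rewrite setDD; exact/setIidPr.
by apply: eq_integral => z zP /=; rewrite patchE mem_set//; apply: PD; exact: set_mem.
Qed.

End marginal.

Section coupling.
Variables (u : signed_measure omega1).
Variables (pi : {measure set (borelRd R d * borelRd R d) -> \bar R}).
Hypothesis cpl : coupling u0 u pi.

Lemma coupling_fin : (pi setT < +oo)%E.
Proof. by rewrite -setXTT cpl.1// ltey_eq fin_num_measure. Qed.

Lemma coupling_null1 : pi ((~` omega0) `*` setT) = 0%E.
Proof.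
rewrite cpl.1; last exact: measurableC.
by apply: u0_concentrated; [exact: measurableC|rewrite setICl].
Qed.

Lemma coupling_null2 : pi (setT `*` (~` omega1)) = 0%E.
Proof.
rewrite cpl.2; last exact: measurableC.
by apply: (@signed_chargeP _ _ _ u); [exact: measurableC|rewrite setICl].
Qed.

Lemma coupling_fst (g : borelRd R d -> R) :
  bounded_measurable (omega0 : set (borelRd R d)) g ->
  \int[u0]_(x in omega0) g x = \int[pi]_(z in P) g z.1.
Proof.
move=> bg.
have pE A : measurable A -> u0 A = pi (fst @^-1` A).
  by move=> mA; rewrite -cpl.1//; congr (pi _); apply/seteqP; split => [z []|z].
apply: (marginal_Rintegral coupling_fin (phi := fst)) => //.
- by move=> z [].
apply/eqP; rewrite eq_le measure_ge0 andbT -coupling_null2.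
apply: le_measure; rewrite ?inE.
- apply: measurableD; last exact: measurable_product.
  by rewrite -[X in measurable X]setTI; exact: measurable_fst.
- by apply: measurableX => //; exact: measurableC.
- by move=> [x y] /= [ox H]; split => // oy; apply: H.
Qed.

Lemma coupling_snd (g : borelRd R d -> R) :
  bounded_measurable (omega1 : set (borelRd R d)) g ->
  cintegral u omega1 g = \int[pi]_(z in P) g z.2.
Proof.
move=> bg.
have pE A : measurable A -> u A = pi (snd @^-1` A).
  by move=> mA; rewrite -cpl.2//; congr (pi _); apply/seteqP; split => [z []|z].
have mpf : measurable_fun setT (snd : borelRd R d * borelRd R d -> borelRd R d).
  exact: measurable_snd.
pose m : {measure set (borelRd R d) -> \bar R} :=
  pushforward pi (snd : borelRd R d * borelRd R d -> borelRd R d).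
rewrite (@cintegral_measure _ _ _ u (m mpf))//; last exact: coupling_fin.
apply: (marginal_Rintegral coupling_fin (phi := snd)) => //.
- by move=> z [].
apply/eqP; rewrite eq_le measure_ge0 andbT -coupling_null1.
apply: le_measure; rewrite ?inE.
- apply: measurableD; last exact: measurable_product.
  by rewrite -[X in measurable X]setTI; exact: measurable_snd.
- by apply: measurableX => //; exact: measurableC.
- by move=> [x y] /= [ox H]; split => // oy; apply: H.
Qed.

Lemma coupling_integrable h : bounded_measurable P h -> pi.-integrable P (EFin \o h).
Proof.
apply: bounded_measurable_integrable; first exact: measurable_product.
apply: le_lt_trans coupling_fin; apply: le_measure; rewrite ?inE//.
exact: measurable_product.
Qed.

Lemma coupling_cst a : \int[pi]_(z in P) a = a * fine (u0 omega0).
Proof.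
have b0 := @bounded_measurable_cst _ (borelRd R d) R (omega0 : set (borelRd R d)) a.
transitivity (\int[pi]_(z in P) cst a z.1) => //.
by rewrite -(coupling_fst b0); exact: Rintegral_cst.
Qed.

Lemma coupling_bound f B : {within omega1, continuous f} ->
  (forall x, omega1 x -> `|f x| <= B) -> `|cintegral u omega1 f| <= B * fine (u0 omega0).
Proof.
move=> cf fB; have bf := continuous_bounded_measurable co1 cf.
have bf2 := bounded_measurable_snd bf.
rewrite coupling_snd// (le_trans (le_normr_Rintegral _ _))//.
- exact: measurable_product.
- exact: (coupling_integrable bf2).
rewrite -coupling_cst; apply: le_Rintegral.
- exact: measurable_product.
- exact: (integrable_norm (coupling_integrable bf2)).
- exact: (coupling_integrable (bounded_measurable_cst _ _)).
- by move=> z [_ oz]; exact: fB.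
Qed.

End coupling.

End couplings.

Section cost.
Context {R : realType} {d : nat}.
Variables omega0 omega1 : set 'rV[R]_d.
Hypotheses (co0 : compact omega0) (co1 : compact omega1).
Variable c : 'rV[R]_d -> 'rV[R]_d -> R.
Hypothesis cc : {within omega0 `*` omega1,
     continuous (fun z : 'rV[R]_d * 'rV[R]_d => c z.1 z.2)}.

Let mo0 : measurable (omega0 : set (borelRd R d)) := compact_measurable_borel co0.
Let mo1 : measurable (omega1 : set (borelRd R d)) := compact_measurable_borel co1.

Notation P := ((omega0 `*` omega1) : set (borelRd R d * borelRd R d)).

(** The cost is continuous for the product topology, whereas measurability for the
product sigma-algebra is needed. Freezing the first variable at the centres of a
partition of unity gives finite sums of products of functions of one variable,
which converge uniformly to the cost. *)
Lemma cost_bounded_measurable : bounded_measurable P (fun z => c z.1 z.2).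
Proof.
have cP : compact (omega0 `*` omega1) by exact: compact_setX.
split; last first.
  have [M [_ bM]] := compact_bounded (continuous_compact cc cP).
  exists (M + 1) => z Pz; apply: (bM (M + 1)); first by rewrite ltrDl.
  by exists z.
have cslice y : omega0 y -> {within omega1, continuous (c y)}.
  move=> oy; apply: eps_within_continuous => x e ox e0.
  have [r r0 Hr] := @within_continuous_eps _ _ _ _ _ (y, x) _ cc (conj oy ox) e0.
  exists r => // x' ox' xx'; apply: (Hr (y, x')) => //=.
  by rewrite prod_normE/= subrr normr0 max_r.
have happrox (n : nat) : exists h : borelRd R d * borelRd R d -> R, measurable_fun P h /\
    forall z, P z -> `|c z.1 z.2 - h z| <= n.+1%:R^-1.
  have n0 : 0 < n.+1%:R^-1 :> R by rewrite invr_gt0 ltr0n.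
  have [r r0 Hr] := compact_uniform_continuous cP cc n0.
  have r20 : 0 < r / 2 by rewrite divr_gt0.
  have [s [chi [so chi0 chi1 chir]]] := C1_partition_of_unity co0 r20.
  (* The centres lie in [omega0]; the value elsewhere only makes [c' y] measurable
     for every index [y] of the sum. *)
  pose c' (y : 'rV[R]_d) : 'rV[R]_d -> R := if y \in omega0 then c y else cst 0.
  have c'_meas y : bounded_measurable (omega1 : set (borelRd R d)) (c' y).
    apply: continuous_bounded_measurable => //; rewrite /c'.
    by case: ifPn => [/set_mem|_]; [exact: cslice|move=> z; exact: cvg_cst].
  exists (fun z => \sum_(y <- s) c' y z.2 * chi y z.1); split.
    apply: measurable_sum => y; apply: measurable_funM.
      exact: (@bounded_measurable_snd _ _ omega0 _ co1 _ (c'_meas y)).1.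
    exact: (@bounded_measurable_fst _ _ _ omega1 co0 _
      (continuous_bounded_measurable co0 (@C1_continuous _ _ _ (chi y)))).1.
  move=> -[x y] /= [ox oy].
  have := @partition_approx _ _ _ s chi (fun w => c w y) (r / 2) n.+1%:R^-1 x chi0 chi1 chir.
  rewrite C1_sumE.
  rewrite (_ : \sum_(y0 <- s) c' y0 y * chi y0 x = \sum_(y0 <- s) c y0 y * chi y0 x).
    2: by apply: eq_big_seq => w ws; rewrite /c' mem_set//; exact: so.
  apply => // w ws xw; apply: ltW.
  apply: (Hr (x, y) (w, y)) => //=; first by split => //; exact: so.
  rewrite prod_normE/= subrr normr0 max_l//.
  rewrite (le_lt_trans (norm_le_enorm _))// (le_lt_trans xw)//; lra.
have [h hP] := choice happrox.
apply: (@measurable_fun_cvg _ _ _ _ h) => [m|z Pz]; first by case: (hP m).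
apply/cvgrPdist_le => e e0; near=> n.
rewrite (le_trans ((hP n).2 z Pz))// -[e]invrK lef_pV2 ?posrE ?invr_gt0 ?ltr0n//.
rewrite (@le_trans _ _ n%:R)// ?ler_nat//.
near: n; exact: nbhs_infty_ger.
Unshelve. all: by end_near. Qed.

End cost.

(** * Quadratic growth of the transport cost *)

Section transport_growth.
Context {R : realType} {d : nat}.
Variables omega0 omega1 : set 'rV[R]_d.
Hypotheses (co0 : compact omega0) (co1 : compact omega1).
Variable c : 'rV[R]_d -> 'rV[R]_d -> R.
Hypothesis cc : {within omega0 `*` omega1,
     continuous (fun z : 'rV[R]_d * 'rV[R]_d => c z.1 z.2)}.
Variable u0 : {finite_measure set (borelRd R d) -> \bar R}.
Hypothesis u0_concentrated : concentrated omega0 u0.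
Variable phibar : C1 omega1.
Variable Tbar : borelRd R d -> borelRd R d.
Hypothesis Tbar_measurable : measurable_fun (omega0 : set (borelRd R d)) Tbar.
Hypothesis Tbar_range : forall x, omega0 x -> omega1 (Tbar x).
Variables (eps0 gamma C : R).
Hypotheses (gamma_gt0 : 0 < gamma) (C_gt0 : 0 < C).
Variable delta : 'rV[R]_d -> R.
Hypothesis delta_ge0 : forall x, omega0 x -> 0 <= delta x.
Hypothesis growth_near : forall x eta, omega0 x -> omega1 eta ->
     enorm (eta - Tbar x) <= eps0 ->
     c x eta - phibar eta >= c x (Tbar x) - phibar (Tbar x)
                             + gamma / 2 * enorm (eta - Tbar x) ^+ 2.
Hypothesis growth_far : forall x eta, omega0 x -> omega1 eta ->
     ~ (enorm (eta - Tbar x) <= eps0) ->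
     c x eta - phibar eta >= c x (Tbar x) - phibar (Tbar x) + delta x.
Hypothesis delta_sublevel : forall kappa, 0 <= kappa ->
     measurable ([set x | omega0 x /\ delta x <= kappa]
                   : set (borelRd R d)) /\
     (u0 [set x | omega0 x /\ (delta x <= kappa)%R] <= (C * kappa)%:E)%E.

Let mo0 : measurable (omega0 : set (borelRd R d)) := compact_measurable_borel co0.
Let mo1 : measurable (omega1 : set (borelRd R d)) := compact_measurable_borel co1.

Notation P := ((omega0 `*` omega1) : set (borelRd R d * borelRd R d)).

Let psi (x : borelRd R d) : R := c x (Tbar x) - phibar (Tbar x).
Let Psi : R := \int[u0]_(x in omega0) psi x.
Let M : R := fine (u0 omega0).
(** The slack in the dual constraint; its integral is the suboptimality of a
coupling. *)
Let gap (z : borelRd R d * borelRd R d) : R := c z.1 z.2 - phibar z.2 - psi z.1.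

Let gap_ge0 z : P z -> 0 <= gap z.
Proof.
move=> [ox oy]; rewrite /gap /psi subr_ge0.
have [n|f] := pselect (enorm (z.2 - Tbar z.1) <= eps0).
  apply: le_trans (growth_near ox oy n).
  by rewrite lerDl mulr_ge0 ?sqr_ge0// divr_ge0// ltW.
by apply: le_trans (growth_far ox oy f); rewrite lerDl delta_ge0.
Qed.

(** The growth conditions make [Tbar x] a minimiser, which yields a formula for the
c-transform that is visibly measurable. *)
Lemma c_transform_transport_map x : omega0 x -> c_transform omega1 c phibar x = psi x.
Proof.
move=> ox; apply/eqP; rewrite eq_le; apply/andP; split.
  apply: ge_inf; last by exists (Tbar x) => //; exact: Tbar_range.
  exists (psi x) => _ [y oy <-]; have := @gap_ge0 (x, y) (conj ox oy).
  by rewrite /gap subr_ge0.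
apply: lb_le_inf; first by exists (psi x), (Tbar x) => //; exact: Tbar_range.
move=> _ [y oy <-]; have := @gap_ge0 (x, y) (conj ox oy).
by rewrite /gap subr_ge0.
Qed.

Let bm_comp_T (f : 'rV[R]_d -> R) : {within omega1, continuous f} ->
  bounded_measurable (omega0 : set (borelRd R d)) (fun x => f (Tbar x)).
Proof.
move=> /(continuous_bounded_measurable co1)[mf [B fB]]; split.
  apply: (measurable_comp mo1 _ mf Tbar_measurable).
  by move=> _ [x ox <-]; exact: Tbar_range.
by exists B => x ox; apply: fB; exact: Tbar_range.
Qed.

Let bm_psi : bounded_measurable (omega0 : set (borelRd R d)) psi.
Proof.
apply: bounded_measurableB; last exact: bm_comp_T (@C1_continuous _ _ _ phibar).
have [mc [B cB]] := cost_bounded_measurable co0 co1 cc.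
split; last by exists B => x ox; apply: (cB (x, Tbar x)); split => //; exact: Tbar_range.
apply: (measurable_comp (g := fun x : borelRd R d => (x, Tbar x)) _ _ mc).
- exact: measurable_product.
- by move=> _ [x ox <-]; split => //; exact: Tbar_range.
(* [Tbar] is measurable on [omega0] only and is first extended by a constant. *)
have mT : measurable_fun setT (Tbar \_ (omega0 : set (borelRd R d))).
  exact/(measurable_restrictT _ mo0).
have := measurable_fun_pair (@measurable_id _ (borelRd R d) setT) mT.
move/(@measurable_funTS _ _ _ _ (omega0 : set (borelRd R d))); apply: eq_measurable_fun => x xo /=.
by rewrite patchE xo.
Qed.

Section coupling.
Variables (u : signed_measure omega1).
Variables (pi : {measure set (borelRd R d * borelRd R d) -> \bar R}).
Hypothesis cpl : coupling u0 u pi.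

Let I (h : borelRd R d * borelRd R d -> R) bh :=
  @coupling_integrable R d _ _ co0 co1 u0 u pi cpl h bh.
Let bm_c := cost_bounded_measurable co0 co1 cc.
Let bm_phi := @bounded_measurable_snd _ _ omega0 _ co1 _
  (continuous_bounded_measurable co1 (@C1_continuous _ _ _ phibar)).
Let bm_psi2 := @bounded_measurable_fst _ _ _ omega1 co0 _ bm_psi.

Let bm_gap : bounded_measurable P gap.
Proof. by apply: bounded_measurableB => //; exact: bounded_measurableB. Qed.

Let mP : measurable P := measurable_product co0 co1.

Lemma transport_integral_fin :
  (\int[pi]_(z in P) (c z.1 z.2)%:E = (\int[pi]_(z in P) c z.1 z.2)%:E)%E.
Proof. by rewrite /Rintegral fineK//; apply: integrable_fin_num => //; exact: I bm_c. Qed.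

Let integral_gap : \int[pi]_(z in P) gap z =
  \int[pi]_(z in P) c z.1 z.2 - cintegral u omega1 phibar - Psi.
Proof.
rewrite /gap RintegralB//; [|exact: I (bounded_measurableB bm_c bm_phi)|exact: I bm_psi2].
rewrite RintegralB//; [|exact: I bm_c|exact: I bm_phi].
rewrite /Psi (coupling_fst co0 co1 cpl bm_psi).
by rewrite (coupling_snd co0 co1 u0_concentrated cpl
  (continuous_bounded_measurable co1 (@C1_continuous _ _ _ phibar))).
Qed.

Lemma coupling_cost_ge :
  cintegral u omega1 phibar + Psi <= \int[pi]_(z in P) c z.1 z.2.
Proof.
by rewrite -subr_ge0 opprD addrA -integral_gap; apply: Rintegral_ge0 => z; exact: gap_ge0.
Qed.

(** Within [eps0] of [Tbar z.1], the distance [r] satisfies [r <= k + r ^+ 2 / k]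
and [r ^+ 2 <= 2 / gamma * gap z]. Further away [f] varies by at most 2, which is
covered by the indicator if [delta <= k] and by [gap z >= delta > k] otherwise. *)
Let test_gap (f : 'rV[R]_d -> R) (k : R) z : BL_test omega1 f -> 0 < k -> P z ->
  f z.2 - f (Tbar z.1) <=
  k + 2 * \1_[set x | omega0 x /\ delta x <= k] z.1 + (2 + 2 / gamma) / k * gap z.
Proof.
move=> [f1 fL] k0 Pz; have [ox oy] := Pz; have oT := Tbar_range ox.
have g0 := gap_ge0 Pz.
have G0 : 0 < 2 / gamma by rewrite divr_gt0.
have i0 : 0 <= 2 * \1_[set x | omega0 x /\ delta x <= k] z.1 :> R.
  by rewrite mulr_ge0.
have k2 : 0 <= 2 / k * gap z by rewrite mulr_ge0// divr_ge0// ltW.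
have k3 : 0 <= (2 / gamma) / k * gap z by rewrite mulr_ge0// divr_ge0 ?ltW.
have -> : (2 + 2 / gamma) / k * gap z = 2 / k * gap z + (2 / gamma) / k * gap z.
  by rewrite -!mulrDl.
have [n|f'] := pselect (enorm (z.2 - Tbar z.1) <= eps0).
  have H : f z.2 - f (Tbar z.1) <= enorm (z.2 - Tbar z.1).
    by rewrite (le_trans (ler_norm _))// fL.
  suff : enorm (z.2 - Tbar z.1) <= k + (2 / gamma) / k * gap z by lra.
  have := growth_near ox oy n; set r := enorm _ => Hr.
  have {}Hr : r ^+ 2 <= (2 / gamma) * gap z.
    rewrite -(invf_div gamma 2) ler_pdivlMl ?divr_gt0//.
    by rewrite /gap /psi; lra.
  rewrite mulrAC -lerBlDl ler_pdivlMr//.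
  by apply: le_trans Hr; have := sqr_ge0 (r - k / 2); rewrite !expr2; nra.
have H2 : f z.2 - f (Tbar z.1) <= 2.
  have := f1 _ oy; have := f1 _ oT; rewrite !ler_norml => /andP[a _] /andP[_ b]; lra.
have Hd : delta z.1 <= gap z.
  by have := growth_far ox oy f'; rewrite /gap /psi; lra.
have [dk|dk] := leP (delta z.1) k.
  have -> : \1_[set x | omega0 x /\ delta x <= k] z.1 = 1 :> R.
    by rewrite indicE mem_set.
  lra.
suff : 2 <= 2 / k * gap z by lra.
by rewrite mulrAC ler_pdivlMr// ler_pM2l// (le_trans (ltW dk)).
Qed.

(** Integration of the pointwise estimate. The left-hand side compares the second
marginal with the image of [u0] under [Tbar], and the last factor is the
suboptimality of the coupling for the dual pair given by [phibar]. *)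
Lemma coupling_test_le (f : 'rV[R]_d -> R) (k : R) : BL_test omega1 f -> 0 < k ->
  cintegral u omega1 f - \int[u0]_(x in omega0) f (Tbar x) <=
  (M + 2 * C) * k + (2 + 2 / gamma) / k *
    (\int[pi]_(z in P) c z.1 z.2 - cintegral u omega1 phibar - Psi).
Proof.
move=> bf k0; have [mS uS] := delta_sublevel (ltW k0).
set S := [set x | _] in mS uS.
have bS : bounded_measurable (omega0 : set (borelRd R d)) (\1_S : borelRd R d -> R).
  split; first exact: measurable_indic.
  by exists 1 => x _; rewrite indicE; case: (_ \in _); rewrite ?normr1 ?normr0.
have bf1 := BL_test_bounded_measurable co1 bf.
have bfT := bm_comp_T (BL_test_continuous bf).
rewrite (coupling_snd co0 co1 u0_concentrated cpl bf1) (coupling_fst co0 co1 cpl bfT).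
have bf2 := @bounded_measurable_snd _ _ omega0 _ co1 _ bf1.
have bfT2 := @bounded_measurable_fst _ _ _ omega1 co0 _ bfT.
have bS2 := @bounded_measurable_fst _ _ _ omega1 co0 _ bS.
have bk : bounded_measurable P (cst k) := bounded_measurable_cst _ _.
have b1 := bounded_measurableD bk (bounded_measurableZ 2 bS2).
have b2 := bounded_measurableZ ((2 + 2 / gamma) / k) bm_gap.
rewrite -RintegralB//; [|exact: I bf2|exact: I bfT2].
apply: le_trans.
  apply: (@le_Rintegral _ _ _ pi P _
    (fun z => (cst k z + 2 * \1_S z.1) + (2 + 2 / gamma) / k * gap z) mP).
  - exact: I (bounded_measurableB bf2 bfT2).
  - exact: I (bounded_measurableD b1 b2).
  - by move=> z Pz; exact: test_gap.
rewrite (RintegralD mP (I b1) (I b2)) (RintegralD mP (I bk) (I (bounded_measurableZ 2 bS2))).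
rewrite (RintegralZl _ mP (I bS2)) (RintegralZl _ mP (I bm_gap)) integral_gap lerD2r.
rewrite (coupling_cst co0 co1 cpl) -(coupling_fst co0 co1 cpl bS).
rewrite [leRHS]mulrDl; apply: lerD; first by rewrite mulrC.
rewrite -mulrA ler_pM2l//.
rewrite /Rintegral integral_indic// setIidl; last by move=> x [].
by rewrite -lee_fin fineK// fin_num_measure.
Qed.

End coupling.

Lemma transport_cost_ge (u : signed_measure omega1) :
  ((cintegral u omega1 phibar + Psi)%:E <= transport_cost omega0 c u0 u)%E.
Proof.
apply: le_ereal_inf_tmp => _ [pi cpl <-].
by rewrite (transport_integral_fin cpl) lee_fin; exact: coupling_cost_ge.
Qed.

Lemma transport_cost_fin (u : signed_measure omega1) :
  (transport_cost omega0 c u0 u < +oo)%E ->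
  transport_cost omega0 c u0 u = (fine (transport_cost omega0 c u0 u))%:E.
Proof.
move=> fin; rewrite fineK// fin_numE -ltey fin andbT -ltNye.
by apply: lt_le_trans (transport_cost_ge u); rewrite ltNyr.
Qed.

Lemma transport_cost_coupling (u : signed_measure omega1) :
  (transport_cost omega0 c u0 u < +oo)%E ->
  exists pi, coupling u0 u pi.
Proof.
move=> fin; apply: contrapT => H; move: fin; rewrite /transport_cost.
rewrite [X in ereal_inf X](_ : _ = set0) ?ereal_inf0//.
by apply/seteqP; split => // x [pi cpl _]; apply: H; exists pi.
Qed.

(** The bound depends on the coupling only through its cost, so that it passes to
the infimum. *)
Lemma transport_test_le (u : signed_measure omega1) (r : R) (f : 'rV[R]_d -> R) (k : R) :
  transport_cost omega0 c u0 u = r%:E ->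
  BL_test omega1 f -> 0 < k ->
  cintegral u omega1 f - \int[u0]_(x in omega0) f (Tbar x) <=
  (M + 2 * C) * k + (2 + 2 / gamma) / k * (r - cintegral u omega1 phibar - Psi).
Proof.
move=> ur bf k0; apply/ler_addgt0Pr => e e0.
have K0 : 0 < (2 + 2 / gamma) / k by rewrite divr_gt0// addr_gt0// divr_gt0.
have e'0 : 0 < e / ((2 + 2 / gamma) / k) by rewrite divr_gt0.
have fn : transport_cost omega0 c u0 u \is a fin_num by rewrite ur.
have [_ [pi cpl <-]] := lb_ereal_inf_adherent e'0 fn.
rewrite -/(transport_cost omega0 c u0 u) ur (transport_integral_fin cpl) lte_fin => /ltW H.
apply: (le_trans (coupling_test_le cpl bf k0)).
set K := (2 + 2 / gamma) / k in K0 H *; set J := Rintegral _ _ _ in H *.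
have HK : K * (J - r) <= e by rewrite mulrC -ler_pdivlMr// lerBlDl.
have -> : K * (J - cintegral u omega1 phibar - Psi) =
  K * (J - r) + K * (r - cintegral u omega1 phibar - Psi) by ring.
by rewrite addrCA addrC lerD.
Qed.

Variable ubar : signed_measure omega1.
Hypothesis ubar_potential : kantorovich_potential omega0 c u0 ubar phibar.

Lemma transport_cost_ubar :
  transport_cost omega0 c u0 ubar = (cintegral ubar omega1 phibar + Psi)%:E.
Proof.
case: ubar_potential => _ <-; congr (_ + _)%:E.
by apply: eq_Rintegral => x /set_mem ox; exact: c_transform_transport_map.
Qed.

(** As [phibar] is a potential for [ubar], the last term of the previous estimate
vanishes; letting [k] tend to 0 shows that [ubar] acts on test functions as the
image of [u0] under [Tbar]. *)
Lemma ubar_test (f : 'rV[R]_d -> R) : BL_test omega1 f ->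
  cintegral ubar omega1 f = \int[u0]_(x in omega0) f (Tbar x).
Proof.
have M0 : 0 < M + 2 * C by rewrite ltr_wpDl ?mulr_gt0// fine_ge0.
have H f' : BL_test omega1 f' ->
    cintegral ubar omega1 f' - \int[u0]_(x in omega0) f' (Tbar x) <= 0.
  move=> bf; apply/ler_addgt0Pr => e e0; rewrite add0r.
  have k0 : 0 < e / (M + 2 * C) by rewrite divr_gt0.
  have := transport_test_le transport_cost_ubar bf k0.
  rewrite (_ : cintegral ubar omega1 phibar + Psi - cintegral ubar omega1 phibar - Psi = 0);
    last by ring.
  by rewrite mulr0 addr0 [_ * (e / _)]mulrC divfK// gt_eqF.
move=> bf; apply/eqP; rewrite eq_le -[X in X && _]subr_le0 H//=.
have := H _ (BL_testN bf).
rewrite cintegralZ//; last exact: BL_test_bounded_measurable.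
rewrite RintegralZl//; first by lra.
apply: bounded_measurable_integrable => //.
  by rewrite ltey_eq fin_num_measure.
exact: bm_comp_T (BL_test_continuous bf).
Qed.

(** Write [s] for the bounded Lipschitz norm and [m] for the right-hand side. With
[A = M + 2 * C] and [b = 2 + 2 / gamma], the estimates above give
[s <= A * k + b / k * m] for all [k > 0], and the choice [k = s / (2 * A)] yields
[s ^+ 2 <= 4 * A * b * m]. *)
Lemma transport_quadratic_growth : exists2 a, 0 < a & forall (u : signed_measure omega1) r r0,
  transport_cost omega0 c u0 u = r%:E -> transport_cost omega0 c u0 ubar = r0%:E ->
  a * BL_norm omega1 (cadd u (copp ubar)) ^+ 2 <=
  r - r0 - cintegral (cadd u (copp ubar)) omega1 phibar.
Proof.
have M0 : 0 < M + 2 * C by rewrite ltr_wpDl ?mulr_gt0// fine_ge0.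
have K0 : 0 < 2 + 2 / gamma by rewrite addr_gt0// divr_gt0.
exists (4 * (M + 2 * C) * (2 + 2 / gamma))^-1 => [|u r r0 ur].
  by rewrite invr_gt0 !mulr_gt0.
rewrite transport_cost_ubar => -[<-].
set s := BL_norm _ _; set A := M + 2 * C in M0 *; set b := 2 + 2 / gamma in K0 *.
have bphi := continuous_bounded_measurable co1 (@C1_continuous _ _ _ phibar).
rewrite cintegralB//.
set m := (X in _ <= X).
have mE : m = r - cintegral u omega1 phibar - Psi by rewrite /m; ring.
have s0 : 0 <= s by exact: BL_norm_ge0.
have m0 : 0 <= m.
  by have := transport_cost_ge u; rewrite ur lee_fin mE; lra.
have key k : 0 < k -> s <= A * k + b / k * m.
  move=> k0; apply: BL_norm_le => // f bf.
  have := transport_test_le ur bf k0.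
  by rewrite -(ubar_test bf) -/A -/b -mE -cintegralB//; exact: BL_test_bounded_measurable.
have [->|s_neq0] := eqVneq s 0; first by rewrite expr0n mulr0.
have sp : 0 < s by rewrite lt_def s_neq0.
have kp : 0 < s / (2 * A) by rewrite divr_gt0// mulr_gt0.
have := key _ kp.
have -> : A * (s / (2 * A)) = s / 2 by field; rewrite gt_eqF.
have -> : b / (s / (2 * A)) * m = 2 * A * b * m / s by field; rewrite !gt_eqF.
rewrite -lerBlDl ler_pdivlMr// => H.
rewrite mulrC ler_pdivrMr ?mulr_gt0//; nra.
Qed.

End transport_growth.

(** * Weak-star sequential compactness in the dual of C1 *)

Section C1_separable.
Context {R : realType} {d : nat}.
Variable omega : set 'rV[R]_d.
Hypothesis co : compact omega.
Hypothesis omega_regular : omega = closure omega°.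
Implicit Types phi psi : C1 omega.

Lemma C1_gradient_cont phi : {within omega, continuous (C1_gradient phi)}.
Proof. exact: (svalP (cid (C1_gradient_exists phi))).1. Qed.

Lemma C1_gradient_int phi x : omega° x -> C1_gradient phi x = gradient phi x.
Proof. exact: (svalP (cid (C1_gradient_exists phi))).2. Qed.

(** In the interior this is the linearity of differentials. On the boundary it
expresses that the continuous extension of a gradient is unique, for which
[omega] must be the closure of its interior. *)
Lemma C1_gradientB phi psi x : omega x ->
  C1_gradient (phi - psi) x = C1_gradient phi x - C1_gradient psi x.
Proof.
move=> ox; apply/eqP; rewrite -subr_eq0 -normr_eq0 eq_le normr_ge0 andbT.
pose D y := C1_gradient (phi - psi) y - (C1_gradient phi y - C1_gradient psi y).
have cD : {within omega, continuous D}.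
  move=> y; apply: cvgB; first exact: C1_gradient_cont.
  by apply: cvgB; exact: C1_gradient_cont.
have D0 y : omega° y -> D y = 0.
  move=> oy; rewrite /D !(C1_gradient_int _ oy).
  have [_ _ /(_ _ oy) dphi _] := C1P phi.
  have [_ _ /(_ _ oy) dpsi _] := C1P psi.
  have dB : differentiable (fun y => phi y - psi y) y by exact: differentiableB.
  rewrite -[X in gradient X]/(fun y => phi y - psi y).
  rewrite (gradient_derive dB) (gradient_derive dphi) (gradient_derive dpsi).
  apply/rowP => i; do 6 rewrite mxE.
  by rewrite (deriveB (diff_derivable dphi) (diff_derivable dpsi)) [in LHS]mxE subrr mxE.
apply/ler_addgt0Pr => e e0; rewrite add0r.
have [r r0 Hr] := within_continuous_eps cD ox e0.
have : closure omega° x by rewrite -omega_regular.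
move=> /(_ (ball x r)) []; first exact: nbhsx_ballx.
move=> y [oy]; rewrite -ball_normE/= => xy.
have := Hr y (interior_subset oy) xy.
by rewrite (D0 _ oy) subr0 => /ltW.
Qed.

Lemma C1_norm_le phi e : 0 <= e -> (forall x, omega x -> `|phi x| <= e) ->
  (forall x, omega x -> enorm (C1_gradient phi x) <= e) -> C1_norm phi <= e.
Proof.
move=> e0 H1 H2.
have H (f : 'rV[R]_d -> R) : (forall x, omega x -> `|f x| <= e) -> supnorm omega f <= e.
  move=> H; rewrite /supnorm.
  have [->|/set0P A0] := eqVneq [set `|f x| | x in omega] set0; first by rewrite sup0.
  by apply: ge_sup => // _ [x ox <-]; exact: H.
rewrite /C1_norm ge_max !H// => x ox /=.
by rewrite ger0_norm ?enorm_ge0// H2.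
Qed.

Let dist3 (V : normedModType R) (a a' b b' : V) (q : R) :
  `|a - a'| <= q -> `|b - b'| <= q -> `|a' - b'| <= q -> `|a - b| <= 3 * q.
Proof.
move=> h1 h2 h3.
have -> : a - b = (a - a') + (a' - b') - (b - b').
  by rewrite addrA subrK opprB addrA subrK.
rewrite (le_trans (ler_normB _ _))// (le_trans (lerD (ler_normD _ _) h2))//.
by rewrite (_ : 3 * q = q + q + q); [rewrite lerD2r lerD|ring].
Qed.

Let net_close (s : seq 'rV[R]_d) (r q : R) phi psi : 0 <= q ->
  (forall x, x \in s -> omega x) ->
  (forall x, omega x -> exists2 y, y \in s & `|x - y| < r) ->
  (forall x y, omega x -> omega y -> `|x - y| < r ->
    `|phi x - phi y| <= q /\ `|C1_gradient phi x - C1_gradient phi y| <= q) ->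
  (forall x y, omega x -> omega y -> `|x - y| < r ->
    `|psi x - psi y| <= q /\ `|C1_gradient psi x - C1_gradient psi y| <= q) ->
  (forall y, y \in s -> `|phi y - psi y| <= q /\
    forall i, `|C1_gradient phi y 0 i - C1_gradient psi y 0 i| <= q) ->
  C1_norm (phi - psi) <= 3 * d.+1%:R * q.
Proof.
move=> q0 so sP oscphi oscpsi H.
have E : 3 * d.+1%:R * q = d.+1%:R * (3 * q) by ring.
apply: C1_norm_le; first by rewrite !mulr_ge0.
  move=> x ox; have [y ys xy] := sP x ox; have oy := so y ys.
  have [h1 _] := oscphi x y ox oy xy; have [h2 _] := oscpsi x y ox oy xy.
  have [h3 _] := H y ys.
  apply: (le_trans (@dist3 R^o _ _ _ _ _ h1 h2 h3)).
  by rewrite E ler_peMl ?mulr_ge0// (ler_nat _ 1).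
move=> x ox; rewrite C1_gradientB//.
have [y ys xy] := sP x ox; have oy := so y ys.
have [_ h1] := oscphi x y ox oy xy; have [_ h2] := oscpsi x y ox oy xy.
have h3 : `|C1_gradient phi y - C1_gradient psi y| <= q.
  by apply: rV_norm_le => // k; rewrite !mxE; exact: (H y ys).2.
apply: (le_trans (enorm_le_norm _)); rewrite E.
apply: ler_pM => //; first by rewrite ler_nat.
exact: dist3 h1 h2 h3.
Qed.

Let code_type : countType := seq (int * seq int)%type.

(** Integer parts at the points of a net: a countable invariant that determines the
values there up to [1 / (m + 1)]. *)
Let net_code (s : seq 'rV[R]_d) m phi : code_type :=
  [seq (Num.floor (m.+1%:R * phi y),
        [seq Num.floor (m.+1%:R * C1_gradient phi y 0 i) | i <- enum 'I_d]) | y <- s].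

Lemma floor_close (a b : R) m : Num.floor (m.+1%:R * a) = Num.floor (m.+1%:R * b) ->
  `|a - b| <= m.+1%:R^-1.
Proof.
move=> E; have m0 : 0 < m.+1%:R :> R by rewrite ltr0n.
rewrite -(ler_pM2l m0) mulfV ?gt_eqF// -{1}[m.+1%:R]gtr0_norm// -normrM mulrBr.
have /andP[] := floor_itv (m.+1%:R * a).
have /andP[] := floor_itv (m.+1%:R * b).
by rewrite E !intrD ler_norml => a1 b1 a2 b2; apply/andP; split; lra.
Qed.

Let net_codeP s m phi psi : net_code s m psi = net_code s m phi ->
  forall y, y \in s -> `|phi y - psi y| <= m.+1%:R^-1 /\
    forall i, `|C1_gradient phi y 0 i - C1_gradient psi y 0 i| <= m.+1%:R^-1.
Proof.
move=> /eq_in_map E y ys.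
have E1 : Num.floor (m.+1%:R * psi y) = Num.floor (m.+1%:R * phi y).
  by have /(congr1 fst) := E y ys.
have /eq_in_map E2 :
    [seq Num.floor (m.+1%:R * C1_gradient psi y 0 i) | i <- enum 'I_d] =
    [seq Num.floor (m.+1%:R * C1_gradient phi y 0 i) | i <- enum 'I_d].
  by have /(congr1 snd) := E y ys.
split; first exact: floor_close (esym E1).
by move=> k; exact: floor_close (esym (E2 k (mem_enum _ k))).
Qed.

(** If the oscillation of a function and its gradient at the scale of a net is at
most [1 / (m + 1)], then their integer parts on the net determine them up to
[3 / (m + 1)] everywhere. Choosing one representative for every attained list of
integer parts gives a countable dense family. *)
Lemma C1_separable : exists e_ : nat -> C1 omega,
  forall phi e, 0 < e -> exists i, C1_norm (phi - e_ i) <= e.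
Proof.
have hnet (n : nat) : exists s : seq 'rV[R]_d, (forall x, x \in s -> omega x) /\
    forall x, omega x -> exists2 y, y \in s & `|x - y| < n.+1%:R^-1.
  by apply: compact_finite_net => //; rewrite invr_gt0 ltr0n.
have [s sP] := choice hnet.
pose osc (n m : nat) phi := forall x y, omega x -> omega y -> `|x - y| < n.+1%:R^-1 ->
  `|phi x - phi y| <= m.+1%:R^-1 /\ `|C1_gradient phi x - C1_gradient phi y| <= m.+1%:R^-1.
pose code (n m : nat) := net_code (s n) m.
pose idx : countType := (nat * nat * code_type)%type.
have /choice[rep repP] : forall i : idx, exists r : C1 omega,
    (exists psi, osc i.1.1 i.1.2 psi /\ code i.1.1 i.1.2 psi = i.2) ->
    osc i.1.1 i.1.2 r /\ code i.1.1 i.1.2 r = i.2.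
  move=> i.
  have [[psi H]|H] := pselect (exists psi, osc i.1.1 i.1.2 psi /\ code i.1.1 i.1.2 psi = i.2).
    by exists psi.
  by exists 0.
exists (fun i => if unpickle i is Some j then rep j else 0) => phi e e0.
have [m me] : exists m : nat, 3 * d.+1%:R * m.+1%:R^-1 <= e.
  exists (Num.truncn (3 * d.+1%:R / e)).
  rewrite ler_pdivrMr ?ltr0n// [leRHS]mulrC -ler_pdivrMr//.
  by apply/ltW; exact: truncnS_gt.
have m0 : 0 < m.+1%:R^-1 :> R by rewrite invr_gt0 ltr0n.
have [_ cphi _ _] := C1P phi.
have [r1 r10 H1] := compact_uniform_continuous co cphi m0.
have [r2 r20 H2] := compact_uniform_continuous co (@C1_gradient_cont phi) m0.
have r0 : 0 < Num.min r1 r2 by rewrite lt_min r10.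
have [n nr] : exists n : nat, n.+1%:R^-1 <= Num.min r1 r2.
  exists (Num.truncn (Num.min r1 r2)^-1).
  rewrite -[leRHS]invrK lef_pV2 ?posrE ?invr_gt0 ?ltr0n//.
  by apply/ltW; exact: truncnS_gt.
have oscphi : osc n m phi.
  move=> x y ox oy /lt_le_trans/(_ nr); rewrite lt_min => /andP[xy1 xy2].
  by split; apply/ltW; [exact: H1|exact: H2].
pose i : idx := (n, m, code n m phi).
exists (pickle i); rewrite pickleK.
have [|oscr coder] := repP i; first by exists phi.
move: (rep i) oscr coder => psi /= oscpsi codepsi.
apply: le_trans me.
exact: (net_close (ltW m0) (sP n).1 (sP n).2 oscphi oscpsi (net_codeP codepsi)).
Qed.

End C1_separable.

Section weak_star_compactness.
Context {R : realType} {d : nat}.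
Variable omega : set 'rV[R]_d.
Hypothesis co : compact omega.
Hypothesis omega_regular : omega = closure omega°.

Let ultra_bounded_cvg (U : set_system nat) (a : nat -> R) B : UltraFilter U ->
  (forall k, `|a k| <= B) -> exists l : R, a k @[k --> U] --> l.
Proof.
move=> UU aB.
have FU : ProperFilter (fmap a U) by exact: fmap_proper_filter.
have cB : compact (`[- B, B]%classic : set R) by exact: segment_compact.
have [|l [_ lc]] := cB (fmap a U) FU.
  by apply: nearW => k /=; rewrite in_itv/= -ler_norml.
exists l => V Vl; have [//|H] := in_ultra_setVsetC (a @^-1` V) UU.
by have [x [Vx nVx]] := lc (~` V) V H Vl.
Qed.

(** Sequential Banach-Alaoglu. The pointwise limit along an ultrafilter exists by
boundedness; on the first [k] members of a dense family it is approximated by a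
member of the sequence with index at least [k], and these members form the
required subsequence. *)
Lemma weak_star_seq_compact (h_ : nat -> C1_dual omega) (K : R) : 0 <= K ->
  (forall k phi, `|h_ k phi| <= K * C1_norm phi) ->
  exists (n_ : nat -> nat) (h : C1_dual omega),
    (forall k, (k <= n_ k)%N) /\ weak_star_cvg (h_ \o n_) h.
Proof.
move=> K0 hK.
have [U [UU Uoo]] := ultraFilterLemma (@eventually_filter).
have PU : ProperFilter U by exact: ultra_proper.
have /choice[L LU] : forall phi, exists l : R, h_ k phi @[k --> U] --> l.
  by move=> phi; exact: (ultra_bounded_cvg UU (hK ^~ phi)).
have Llin a phi psi : L (a *: phi + psi) = a * L phi + L psi.
  have H1 : a * h_ k phi + h_ k psi @[k --> U] --> a * L phi + L psi.
    by apply: cvgD => //; apply: cvgM => //; exact: cvg_cst.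
  have H2 := LU (a *: phi + psi).
  have E : (fun k => h_ k (a *: phi + psi)) = (fun k => a * h_ k phi + h_ k psi).
    by apply/funext => k; rewrite C1_dualP.
  rewrite E in H2; exact: (cvg_unique (@norm_hausdorff _ _) H2 H1).
have LK phi : `|L phi| <= K * C1_norm phi.
  apply/ler_addgt0Pr => e e0.
  have /cvgrPdist_lt/(_ _ e0)/filter_ex[k Hk] := LU phi.
  rewrite -[L phi](subrK (h_ k phi)) (le_trans (ler_normD _ _))// addrC lerD//.
  exact: ltW.
have Lp : L \in @C1_dual_pred R d omega by apply/asboolP; split => //; exists K.
pose h := MkC1_dual Lp.
have [e_ eP] := C1_separable co omega_regular.
have hn k : exists n, (k <= n)%N /\
    forall i, (i <= k)%N -> `|L (e_ i) - h_ n (e_ i)| < k.+1%:R^-1.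
  have k0 : 0 < k.+1%:R^-1 :> R by rewrite invr_gt0 ltr0n.
  have H j : U [set n | forall i, (i < j)%N -> `|L (e_ i) - h_ n (e_ i)| < k.+1%:R^-1].
    elim: j => [|j IH]; first by apply: nearW.
    have /cvgrPdist_lt/(_ _ k0) Hj := LU (e_ j).
    apply: filterS (filterI IH Hj) => n [H1 H2] i; rewrite ltnS leq_eqVlt => /orP[/eqP->//|].
    exact: H1.
  have Hk : U [set n | (k <= n)%N] by apply: Uoo; exists k.
  have [n [kn Hn]] := filter_ex (filterI Hk (H k.+1)).
  by exists n; split => // i ik; exact: Hn.
have [n_ nP] := choice hn.
exists n_, h; split => [k|phi]; first by case: (nP k).
apply/cvgrPdist_le => e e0.
have K1 : 0 < 2 * K + 1 by rewrite ltr_wpDl// mulr_ge0.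
have e'0 : 0 < e / 2 / (2 * K + 1) by rewrite !divr_gt0.
have [i Hi] := eP phi _ e'0.
have xiB (xi : C1_dual omega) psi : xi phi = xi psi + xi (phi - psi).
  by rewrite -{1}(subrK psi phi) addrC -{1}[psi]scale1r C1_dualP mul1r.
near=> k.
have ik : (i <= k)%N by near: k; exists i.
have ke : k.+1%:R^-1 <= e / 2.
  rewrite -[leRHS]invrK lef_pV2 ?posrE ?invr_gt0 ?divr_gt0 ?ltr0n//.
  rewrite (@le_trans _ _ k%:R) ?ler_nat//; near: k; exact: nbhs_infty_ger.
have H1 := (nP k).2 i ik.
rewrite /= [L phi](xiB h (e_ i)) (xiB (h_ (n_ k)) (e_ i)) /=.
rewrite opprD addrACA (le_trans (ler_normD _ _))//.
have H2 : `|L (phi - e_ i) - h_ (n_ k) (phi - e_ i)| <= 2 * K * (e / 2 / (2 * K + 1)).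
  rewrite (le_trans (ler_normB _ _))// -mulrA.
  rewrite (_ : 2 * _ = K * (e / 2 / (2 * K + 1)) + K * (e / 2 / (2 * K + 1))); last by ring.
  by rewrite lerD// ?(le_trans (LK _))// ?(le_trans (hK _ _))// ler_wpM2l.
have H3 : 2 * K * (e / 2 / (2 * K + 1)) <= e / 2.
  by rewrite mulrA ler_pdivrMr// mulrC ler_pM2l ?divr_gt0// lerDl.
rewrite [e]splitr lerD//; first by rewrite (le_trans (ltW H1)).
exact: le_trans H2 H3.
Unshelve. all: by end_near. Qed.

End weak_star_compactness.

(** * The transport cost on the dual of C1 *)

Section duality.
Context {R : realType} {d : nat}.
Variables omega0 omega1 : set 'rV[R]_d.
Hypotheses (co0 : compact omega0) (co1 : compact omega1).
Variable c : 'rV[R]_d -> 'rV[R]_d -> R.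
Variable u0 : {finite_measure set (borelRd R d) -> \bar R}.
Implicit Types u v : signed_measure omega1.

Lemma transport_cost_ext u v : (forall A, measurable A -> u A = v A) ->
  transport_cost omega0 c u0 u = transport_cost omega0 c u0 v.
Proof.
move=> uv; rewrite /transport_cost (_ : coupling u0 u = coupling u0 v)//.
apply/seteqP; split => pi [p1 p2]; split => // B mB; rewrite p2//; first exact: uv.
by rewrite uv.
Qed.

Lemma dual_transport_costE u :
  dual_transport_cost omega0 c u0 co1 (Pi co1 u) = transport_cost omega0 c u0 u.
Proof.
rewrite /dual_transport_cost; case: pselect => [ex|]; last by case; exists u.
by apply: transport_cost_ext; apply: (Pi_inj (co := co1)); exact: svalP (cid ex).
Qed.

Lemma dual_transport_cost_dom (xi : C1_dual omega1) :
  (dual_transport_cost omega0 c u0 co1 xi < +oo)%E -> exists u, Pi co1 u = xi.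
Proof. by rewrite /dual_transport_cost; case: pselect => //; rewrite ltxx. Qed.

Lemma PiB u v (phi : C1 omega1) : (Pi co1 u - Pi co1 v) phi =
  cintegral (cadd u (copp v)) omega1 phi.
Proof.
rewrite cintegralB//; first exact: compact_measurable_borel.
exact: (continuous_bounded_measurable co1 (@C1_continuous _ _ _ phi)).
Qed.

Hypothesis u0_concentrated : concentrated omega0 u0.

(** All test functions are approximated at once by means of a single finite
partition of unity, with an error controlled by the common mass of the measures.
Hence only finitely many C1 functions have to be integrated. *)
Lemma BL_norm_cvg0 (u_ : nat -> signed_measure omega1) u :
  (forall k, exists pi, coupling u0 (u_ k) pi) -> (exists pi, coupling u0 u pi) ->
  (forall phi : C1 omega1, cintegral (cadd (u_ k) (copp u)) omega1 phi @[k --> \oo] --> 0) ->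
  BL_norm omega1 (cadd (u_ k) (copp u)) @[k --> \oo] --> 0.
Proof.
move=> cpl [pi cplu] H; apply/cvgrPdist_le => e e0.
pose M := fine (u0 omega0).
have M0 : 0 <= M by exact: fine_ge0.
have mo1 := compact_measurable_borel co1.
have M1 : 0 < 2 * M + 1 by rewrite ltr_wpDl// mulr_ge0.
pose eta := e / 2 / (2 * M + 1).
have eta0 : 0 < eta by rewrite !divr_gt0.
have [s [chi [so chi0 chi1 chir]]] := C1_partition_of_unity co1 eta0.
pose S k := \sum_(y <- s) `|cintegral (cadd (u_ k) (copp u)) omega1 (chi y)|.
have : S k @[k --> \oo] --> \sum_(y <- s) `|0 : R|.
  by apply: cvg_sum => y; apply: cvg_norm; exact: H.
rewrite normr0 big1// => S0.
have e20 : 0 < e / 2 by rewrite divr_gt0.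
have /cvgrPdist_le/(_ _ e20) := S0; apply: filterS => k; rewrite sub0r normrN.
have Sk0 : 0 <= S k by rewrite sumr_ge0.
rewrite ger0_norm// => Sk.
rewrite sub0r normrN ger0_norm ?BL_norm_ge0//; apply: BL_norm_le => // f bf.
have [f1 fL] := bf.
pose g : C1 omega1 := \sum_(y <- s) f y *: chi y.
have cf := BL_test_continuous bf; have cg := @C1_continuous _ _ _ g.
have bmf := continuous_bounded_measurable co1 cf.
have bmg := continuous_bounded_measurable co1 cg.
have fg x : omega1 x -> `|f x - g x| <= eta.
  move=> ox; apply: (partition_approx chi0 chi1 chir) => // y ys xy.
  by rewrite (le_trans (fL _ _ ox (so _ ys))).
have cfg : {within omega1, continuous (fun x => f x - g x)}.
  by move=> x; apply: cvgB; [exact: cf|exact: cg].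
have B1 : `|cintegral (u_ k) omega1 f - cintegral (u_ k) omega1 g| <= eta * M.
  rewrite -cintegralBr//; have [pik cplk] := cpl k.
  exact: (coupling_bound co0 co1 u0_concentrated cplk cfg fg).
have B2 : `|cintegral u omega1 f - cintegral u omega1 g| <= eta * M.
  by rewrite -cintegralBr//; exact: (coupling_bound co0 co1 u0_concentrated cplu cfg fg).
have B3 : `|cintegral (cadd (u_ k) (copp u)) omega1 g| <= S k.
  rewrite -PiB C1_dual_sumE (le_trans (ler_norm_sum _ _ _))//.
  rewrite /S big_seq [leRHS]big_seq; apply: ler_sum => y ys.
  by rewrite normrM PiB ler_piMl// f1//; exact: so.
rewrite cintegralB// in B3.
rewrite cintegralB//.
have EM : 2 * (eta * M) <= e / 2.
  rewrite /eta (_ : 2 * _ = e / 2 * (2 * M / (2 * M + 1))); last by ring.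
  by rewrite ler_piMr ?(ltW e20)// ler_pdivrMr// mul1r lerDl.
move: B1 B2 B3; rewrite !ler_norml => /andP[_ b1] /andP[b2 _] /andP[_ b3].
lra.
Qed.

End duality.

(** * Second-order conditions *)

Lemma limn_einf_ge_near {R : realType} (u : nat -> \bar R) (l : \bar R) :
  (\forall k \near \oo, (l <= u k)%E) -> (l <= limn_einf u)%E.
Proof.
move=> [N _ H]; rewrite limn_einf_lim.
rewrite (cvg_lim (@ereal_hausdorff R) (@cvg_einfs_sup R u)).
apply: (@le_trans _ _ (einfs u N)); last by apply: ereal_sup_ubound; exists N.
by apply: le_ereal_inf_tmp => _ [k /= Nk <-]; exact: H.
Qed.

Lemma limn_einf_le_cvg {R : realType} (u : nat -> \bar R) (v : nat -> R) (l : R) :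
  (forall k, (u k <= (v k)%:E)%E) -> v k @[k --> \oo] --> l ->
  (limn_einf u <= l%:E)%E.
Proof.
move=> uv vl.
have /cvg_limn_einf_sup[<- _] : (fun k => (v k)%:E) @ \oo --> l%:E.
  by apply: cvg_EFin vl; exact: nearW.
rewrite !limn_einf_lim; apply: lee_lim; [exact: is_cvg_einfs|exact: is_cvg_einfs|].
apply: nearW => n; apply: le_ereal_inf_tmp => _ [k /= nk <-].
by apply: le_trans (uv k); apply: ereal_inf_lbound; exists k.
Qed.

Lemma cvg_comp_ge {T : topologicalType} (a : nat -> T) (n_ : nat -> nat) (l : T) :
  (forall k, (k <= n_ k)%N) -> a k @[k --> \oo] --> l -> a (n_ k) @[k --> \oo] --> l.
Proof.
move=> nk al; apply: (cvg_comp n_ a _ al) => A [N _ NA].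
by exists N => // k /= Nk; apply: NA => /=; exact: leq_trans (nk k).
Qed.

Section second_order.
Context {R : realType} {d : nat}.
Variables omega0 omega1 : set 'rV[R]_d.
Hypotheses (co0 : compact omega0) (co1 : compact omega1).
Hypothesis omega1_regular : omega1 = closure omega1°.
Variable c : 'rV[R]_d -> 'rV[R]_d -> R.
Variable u0 : {finite_measure set (borelRd R d) -> \bar R}.
Hypothesis u0_concentrated : concentrated omega0 u0.
Variable ubar : signed_measure omega1.
Variables (alpha : R) (alpha_gt0 : 0 < alpha).
Variables (F : signed_measure omega1 -> R) (calF : C1_dual omega1 -> R).
Hypothesis calF_extends : forall u, calF (Pi co1 u) = F u.
Variable F' : C1 omega1.
Variable F'' : C1_dual omega1 -> C1_dual omega1 -> R.
Hypothesis F''00 : F'' 0 0 = 0.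

Notation D := (@transport_cost R d omega0 omega1 c u0).
Notation calD := (dual_transport_cost omega0 c u0 co1).
Notation BL u := (BL_norm omega1 (cadd u (copp ubar))).

Implicit Types u : signed_measure omega1.

Hypothesis F_expansion : forall (t : nat -> R) (h_ : nat -> C1_dual omega1)
     (h : C1_dual omega1),
     (forall k, 0 < t k) -> t @ \oo --> 0 -> weak_star_cvg h_ h ->
     (forall k, (calD (Pi co1 ubar + t k *: h_ k)%R < +oo)%E) ->
     (calF (Pi co1 ubar + t k *: h_ k)
        - calF (Pi co1 ubar) - t k * h_ k F'
        - 2^-1 * t k ^+ 2 * F'' (h_ k) (h_ k)) / t k ^+ 2
       @[k --> \oo] --> 0.
Hypothesis F''_continuous : forall (h_ : nat -> C1_dual omega1) (h : C1_dual omega1),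
     weak_star_cvg h_ h -> F'' (h_ k) (h_ k) @[k --> \oo] --> F'' h h.
Variable phibar : C1 omega1.
Hypothesis phibarE : phibar = - (2 / alpha) *: F'.

Variable (r0 : R).
Hypothesis D_ubar : D ubar = r0%:E.
Hypothesis D_fin : forall u, (D u < +oo)%E -> D u = (fine (D u))%:E.
Variable K : R.
Hypothesis K_ge0 : 0 <= K.
Hypothesis Pi_le : forall (nu : {charge set (borelRd R d) -> \bar R}) (phi : C1 omega1),
  `|cintegral nu omega1 phi| <= K * C1_norm phi * BL_norm omega1 nu.

Let C1_dualZ (xi : C1_dual omega1) a phi : xi (a *: phi) = a * xi phi.
Proof.
have xi0 : xi 0 = 0.
  by have := C1_dualP xi (-1) 0 0; rewrite scaler0 addr0 mulN1r addNr.
by rewrite -[a *: phi]addr0 C1_dualP xi0 addr0.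
Qed.

(** The rescaled increment of [D] whose lower limits define the weak-star second
subderivative, and the remainder in the expansion of [calF], at the measure [u]
and for the step [t] in the direction [h]. *)
Let quot u t (h : C1_dual omega1) : R :=
  (fine (D u) - r0 - t * h phibar) / (t ^+ 2 / 2).

Let rem u t (h : C1_dual omega1) : R :=
  (F u - F ubar - t * h F' - 2^-1 * t ^+ 2 * F'' h h) / t ^+ 2.

(** The first-order terms cancel because [phibar] is [- (2 / alpha) *: F']. *)
Let expansion u t h : t != 0 ->
  F u - F ubar + alpha / 2 * (fine (D u) - r0) =
  t ^+ 2 / 2 * (F'' h h + 2 * rem u t h + alpha / 2 * quot u t h).
Proof.
move=> t0; rewrite /quot /rem phibarE C1_dualZ; field.
by rewrite t0 gt_eqF.
Qed.

Let quotE u t h : Pi co1 u = Pi co1 ubar + t *: h -> (D u < +oo)%E ->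
  ((calD (Pi co1 ubar + t *: h)%R - calD (Pi co1 ubar) - (t * h phibar)%:E)
     * ((t ^+ 2 / 2)^-1)%:E = (quot u t h)%:E)%E.
Proof.
by move=> <- fin; rewrite !dual_transport_costE// D_ubar (D_fin fin).
Qed.

Let rem_cvg (t : nat -> R) (h_ : nat -> C1_dual omega1) h (u_ : nat -> signed_measure omega1) :
  (forall k, 0 < t k) -> t @ \oo --> 0 -> weak_star_cvg h_ h ->
  (forall k, Pi co1 (u_ k) = Pi co1 ubar + t k *: h_ k) ->
  (forall k, (D (u_ k) < +oo)%E) ->
  rem (u_ k) (t k) (h_ k) @[k --> \oo] --> 0.
Proof.
move=> t0 tc hc uE Dfin.
have dom k : (calD (Pi co1 ubar + t k *: h_ k)%R < +oo)%E.
  by rewrite -uE dual_transport_costE.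
have := F_expansion t0 tc hc dom.
by under eq_fun do rewrite -uE !calF_extends.
Qed.

Let D_coupling u : (D u < +oo)%E -> exists pi, coupling u0 u pi.
Proof. exact: transport_cost_coupling. Qed.

Let Pi_dir u t (h : C1_dual omega1) (phi : C1 omega1) : Pi co1 u = Pi co1 ubar + t *: h ->
  cintegral (cadd u (copp ubar)) omega1 phi = t * h phi.
Proof. by move=> uE; rewrite -(PiB co1) uE addrAC subrr add0r. Qed.

(** The quotients along a sequence are compared with those of the quadratic growth:
the bounded Lipschitz norm of the increment is at least a multiple of its action
on a function [phi] with [h phi != 0], which gives a uniform positive margin [q].
The expansion of [F] requires finite costs at all indices; arguing by
contradiction allows one to pass to a subsequence with this property. *)
Lemma growth_second_order (kappa eps : R) : 0 < kappa -> 0 < eps ->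
  (forall u, BL u <= eps ->
    ((F u)%:E + (alpha / 2)%:E * D u >=
     (F ubar)%:E + (alpha / 2)%:E * D ubar + (kappa / 2 * BL u ^+ 2)%:E)%E) ->
  forall h : C1_dual omega1, h != 0 ->
    (0 < (F'' h h)%:E + (alpha / 2)%:E *
        weak_star_subderivative2 calD (Pi co1 ubar) phibar h)%E.
Proof.
move=> kappa0 eps0 growth h h0.
have [phi hphi] : exists phi, h phi != 0.
  apply: contrapT => H; move/negP: h0; apply; apply/eqP; apply: val_inj.
  by apply/funext => phi /=; apply: contrapT => /eqP Hp; apply: H; exists phi.
pose N := K * C1_norm phi.
have N0 : 0 <= N.
  by rewrite mulr_ge0// C1_norm_ge0.
have N1 : 0 < N + 1 by rewrite ltr_wpDl.
pose q := kappa * (h phi / (N + 1)) ^+ 2.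
have q0 : 0 < q by rewrite mulr_gt0// exprn_even_gt0//= mulf_neq0// invr_neq0// gt_eqF.
suff L : (((2 / alpha) * (q - F'' h h))%:E <=
    weak_star_subderivative2 calD (Pi co1 ubar) phibar h)%E.
  apply: (@lt_le_trans _ _ q%:E); first by rewrite lte_fin.
  have a2 : (0%R <= (alpha / 2)%:E)%E by rewrite lee_fin divr_ge0// ltW.
  apply: le_trans (leeD2l _ (lee_wpmul2l a2 L)).
  rewrite -EFinM -EFinD lee_fin.
  have -> : F'' h h + alpha / 2 * (2 / alpha * (q - F'' h h)) = q.
    by field; rewrite gt_eqF.
  by [].
apply: le_ereal_inf_tmp => _ [t [h_ [t0 tc hc ->]]].
apply/lee_addgt0Pr => e e0; rewrite -leeBlDr//.
apply: limn_einf_ge_near.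
pose X k := ((calD (Pi co1 ubar + t k *: h_ k)%R - calD (Pi co1 ubar)
  - (t k * h_ k phibar)%:E) * ((t k ^+ 2 / 2)^-1)%:E)%E.
pose l := ((2 / alpha * (q - F'' h h))%:E - e%:E)%E.
apply: contrapT => H.
have /choice[n_ nP] : forall k, exists n, (k <= n)%N /\ (X n < l)%E.
  move=> k; apply: contrapT => Hk; apply: H; exists k => // n /= kn.
  by rewrite leNgt; apply/negP => Xl; apply: Hk; exists n.
have nk k : (k <= n_ k)%N by case: (nP k).
pose t' := t \o n_; pose h' := h_ \o n_.
have t'0 k : 0 < t' k by exact: t0.
have t'c : t' k @[k --> \oo] --> 0 by exact: cvg_comp_ge tc.
have h'c : weak_star_cvg h' h.
  by move=> psi; apply: (@cvg_comp_ge _ (fun k => h_ k psi)) => //; exact: hc.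
have dom k : (calD (Pi co1 ubar + t' k *: h' k)%R < +oo)%E.
  rewrite ltNge leye_eq; apply/negP => /eqP Dy.
  have [_] := nP k; rewrite /X -/(t' k) -/(h' k) Dy dual_transport_costE// D_ubar.
  by rewrite /= gt0_mulye ?lte_fin ?invr_gt0 ?divr_gt0 ?exprn_gt0// /l ltNge leey.
have /choice[u_ uE] := fun k => dual_transport_cost_dom (dom k).
have Dfin k : (D (u_ k) < +oo)%E by rewrite -(dual_transport_costE omega0 co1 c u0) uE.
have XE k : X (n_ k) = (quot (u_ k) (t' k) (h' k))%:E by rewrite -quotE.
have remc := rem_cvg t'0 t'c h'c uE Dfin.
have BLc : BL (u_ k) @[k --> \oo] --> 0.
  apply: (BL_norm_cvg0 co0 co1 u0_concentrated).
  - by move=> k; exact: D_coupling.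
  - by apply: D_coupling; rewrite D_ubar ltry.
  - move=> psi; under eq_fun do rewrite (Pi_dir psi (uE _)).
    by rewrite -(mul0r (h psi)); apply: cvgM; [exact: t'c|exact: h'c].
pose low k := (2 / alpha) * (kappa * (h' k phi / (N + 1)) ^+ 2 - F'' (h' k) (h' k)
  - 2 * rem (u_ k) (t' k) (h' k)).
have lowc : low k @[k --> \oo] --> (2 / alpha) * (q - F'' h h - 2 * 0).
  apply: cvgM; first exact: cvg_cst.
  apply: cvgB; last by apply: cvgM => //; exact: cvg_cst.
  apply: cvgB; last exact: F''_continuous.
  apply: cvgM; first exact: cvg_cst.
  apply: (@cvg_comp _ _ _ (fun k => h' k phi / (N + 1)) (fun a => a ^+ 2));
    last exact: exprn_continuous.
  by apply: cvgM; [exact: h'c|exact: cvg_cst].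
have low_le : \forall k \near \oo, low k <= quot (u_ k) (t' k) (h' k).
  have /cvgrPdist_le/(_ _ eps0) := BLc; apply: filterS => k.
  rewrite sub0r normrN => /(le_trans (ler_norm _))/growth.
  rewrite D_ubar (D_fin (Dfin k)) -!EFinM -!EFinD lee_fin => G.
  have tk2 : 0 < t' k ^+ 2 by rewrite exprn_gt0.
  have BLh : `|t' k * h' k phi| <= (N + 1) * BL (u_ k).
    rewrite -(Pi_dir phi (uE k)) (le_trans (Pi_le _ _))// ler_wpM2r ?BL_norm_ge0//.
    by rewrite lerDl.
  have BL2 : (t' k) ^+ 2 * (h' k phi / (N + 1)) ^+ 2 <= BL (u_ k) ^+ 2.
    rewrite -exprMn mulrA expr_div_n ler_pdivrMr ?exprn_gt0//.
    rewrite [leRHS]mulrC -exprMn -[leLHS]real_normK ?num_real//.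
    have B0 : 0 <= (N + 1) * BL (u_ k) by rewrite mulr_ge0 ?BL_norm_ge0// ltW.
    by rewrite ler_pXn2r ?nnegrE.
  have E := @expansion (u_ k) (t' k) (h' k) (lt0r_neq0 (t'0 k)).
  have G2 : kappa / 2 * (t' k ^+ 2 * (h' k phi / (N + 1)) ^+ 2) <=
      t' k ^+ 2 / 2 * (F'' (h' k) (h' k) + 2 * rem (u_ k) (t' k) (h' k) +
      alpha / 2 * quot (u_ k) (t' k) (h' k)).
    rewrite -E.
    have k2 : 0 <= kappa / 2 by rewrite divr_ge0// ltW.
    by have := ler_wpM2l k2 BL2; lra.
  rewrite -(_ : t' k ^+ 2 / 2 * (kappa * (h' k phi / (N + 1)) ^+ 2) =
    kappa / 2 * (t' k ^+ 2 * (h' k phi / (N + 1)) ^+ 2)) in G2; last by ring.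
  rewrite ler_pM2l ?divr_gt0// in G2.
  rewrite /low -(invf_div alpha 2) ler_pdivrMl ?divr_gt0//; lra.
have : \forall k \near \oo, (2 / alpha) * (q - F'' h h) - e <= low k.
  have /cvgrPdist_le/(_ _ e0) := lowc; apply: filterS => k.
  by rewrite mulr0 subr0 => /(le_trans (ler_norm _)); lra.
move=> /(filterI low_le) [M _ /(_ M (leqnn M)) [H1 H2]].
have [_] := nP M; rewrite XE /l -EFinB lte_fin ltNge => /negP; apply.
exact: le_trans H1.
Qed.

Variable a : R.
Hypothesis a_gt0 : 0 < a.
Hypothesis D_growth : forall u r, D u = r%:E ->
  a * BL u ^+ 2 <= r - r0 - cintegral (cadd u (copp ubar)) omega1 phibar.

(** If growth fails, there are measures [u_ k] tending to [ubar] along which it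
fails with constants tending to 0. Dividing the increments by their bounded
Lipschitz norms [t k] gives directions that are bounded in the dual of [C1], with
a weak-star convergent subsequence. A nonzero limit [h] would have a nonpositive
second-order form. If [h = 0], then [F''] tends to 0 along the directions while
the quotients of the transport cost stay above [2 * a]. *)
Lemma second_order_growth :
  (forall h : C1_dual omega1, h != 0 ->
    (0 < (F'' h h)%:E + (alpha / 2)%:E *
        weak_star_subderivative2 calD (Pi co1 ubar) phibar h)%E) ->
  exists kappa eps : R, [/\ 0 < kappa, 0 < eps & forall u, BL u <= eps ->
    ((F u)%:E + (alpha / 2)%:E * D u >=
     (F ubar)%:E + (alpha / 2)%:E * D ubar + (kappa / 2 * BL u ^+ 2)%:E)%E].
Proof.
move=> ssc; apply: contrapT => H.
have a2 : 0 < alpha / 2 by rewrite divr_gt0.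
have /choice[u_ uP] : forall k : nat, exists u, BL u <= k.+1%:R^-1 /\ exists r,
    D u = r%:E /\ F u + alpha / 2 * r < F ubar + alpha / 2 * r0 + k.+1%:R^-1 / 2 * BL u ^+ 2.
  move=> k; apply: contrapT => Hk; apply: H.
  have k0 : 0 < k.+1%:R^-1 :> R by rewrite invr_gt0 ltr0n.
  exists k.+1%:R^-1, k.+1%:R^-1; split => // u ue; rewrite leNgt; apply/negP => G.
  apply: Hk; exists u; split => //.
  have Dfin : (D u < +oo)%E.
    rewrite ltNge leye_eq; apply/negP => /eqP Dy; move: G.
    by rewrite Dy gt0_muley ?lte_fin// addey// ltNge leey.
  exists (fine (D u)); split; first exact: D_fin.
  by move: G; rewrite D_ubar (D_fin Dfin) -!EFinM -!EFinD lte_fin.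
pose t k := BL (u_ k).
have Dfin k : (D (u_ k) < +oo)%E by have [_ [r [-> _]]] := uP k; rewrite ltry.
have uF k : F (u_ k) - F ubar + alpha / 2 * (fine (D (u_ k)) - r0) <
    k.+1%:R^-1 / 2 * t k ^+ 2.
  have [_ [r [-> Hr]]] := uP k; rewrite -/(t k) in Hr.
  by rewrite /fine mulrBr addrACA -opprD ltrBlDl.
have t0 k : 0 < t k.
  rewrite lt_def BL_norm_ge0// andbT; apply/eqP => tk0.
  have PE : Pi co1 (u_ k) = Pi co1 ubar.
    apply/eqP; rewrite -subr_eq0; apply/eqP; apply: val_inj; apply/funext => phi.
    rewrite -[LHS]/((Pi co1 (u_ k) - Pi co1 ubar) phi) PiB.
    apply/eqP; rewrite -normr_eq0 eq_le normr_ge0 andbT.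
    by rewrite (le_trans (Pi_le _ _))// -/(t k) tk0 mulr0.
  have := uF k; rewrite -!calF_extends PE -(dual_transport_costE omega0 co1 c u0) PE.
  by rewrite dual_transport_costE// D_ubar /= !subrr mulr0 addr0 tk0 expr0n/= mulr0 ltxx.
pose h_ k : C1_dual omega1 := (t k)^-1 *: (Pi co1 (u_ k) - Pi co1 ubar).
have uE k : Pi co1 (u_ k) = Pi co1 ubar + t k *: h_ k.
  by rewrite /h_ scalerA mulfV ?gt_eqF// scale1r addrC subrK.
have hK k phi : `|h_ k phi| <= K * C1_norm phi.
  rewrite -[h_ k phi]/((t k)^-1 * (Pi co1 (u_ k) - Pi co1 ubar) phi) PiB normrM.
  rewrite gtr0_norm ?invr_gt0// ler_pdivrMl// mulrC.
  rewrite (le_trans (Pi_le _ _))// -/(t k) ler_pM2r.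
have [n_ [h [nk hc]]] := weak_star_seq_compact co1 omega1_regular K_ge0 hK.
pose t' := t \o n_; pose h' := h_ \o n_; pose u' := u_ \o n_.
have t'0 k : 0 < t' k by exact: t0.
have tc : t @ \oo --> 0.
  apply/cvgrPdist_le => e e0; near=> k.
  rewrite sub0r normrN ger0_norm ?(ltW (t0 k))//.
  have [tk _] := uP k; apply: (le_trans tk).
  rewrite -[leRHS]invrK lef_pV2 ?posrE ?invr_gt0 ?ltr0n//.
  rewrite (@le_trans _ _ k%:R) ?ler_nat//; near: k; exact: nbhs_infty_ger.
have t'c : t' k @[k --> \oo] --> 0 by exact: cvg_comp_ge tc.
have remc : rem (u' k) (t' k) (h' k) @[k --> \oo] --> 0.
  by apply: (rem_cvg t'0 t'c hc) => k; [exact: uE|exact: Dfin].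
pose up k := (2 / alpha) * (k.+1%:R^-1 - F'' (h' k) (h' k)
  - 2 * rem (u' k) (t' k) (h' k)).
have upc : up k @[k --> \oo] --> (2 / alpha) * (0 - F'' h h - 2 * 0).
  apply: cvgM; first exact: cvg_cst.
  apply: cvgB; last by apply: cvgM => //; exact: cvg_cst.
  apply: cvgB; last exact: F''_continuous.
  exact: cvg_harmonic.
have quot_up k : quot (u' k) (t' k) (h' k) <= up k.
  have tk2 : 0 < t' k ^+ 2 / 2 by apply: divr_gt0; [exact: exprn_gt0 (t'0 k)|exact: ltr0Sn].
  have := uF (n_ k); rewrite (@expansion _ (t' k) (h' k) (lt0r_neq0 (t'0 k))).
  rewrite -/(u' k) -/(t' k) [ltRHS]mulrAC -[ltRHS]mulrA [ltRHS]mulrC.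
  move=> G; rewrite (ltr_pM2l tk2) in G.
  have n1 : (n_ k).+1%:R^-1 <= k.+1%:R^-1 :> R.
    by rewrite lef_pV2 ?posrE ?ltr0n// ler_nat ltnS nk.
  rewrite /up -(invf_div alpha 2) ler_pdivlMl// -addrA -opprD lerBrDl.
  exact: ltW (lt_le_trans G n1).
have quot_lo k : 2 * a <= quot (u' k) (t' k) (h' k).
  have tk2 : 0 < t' k ^+ 2 / 2 by apply: divr_gt0; [exact: exprn_gt0 (t'0 k)|exact: ltr0Sn].
  rewrite /quot ler_pdivlMr//; have := D_growth (D_fin (Dfin (n_ k))).
  rewrite (Pi_dir phibar (uE _)); apply: le_trans.
  by rewrite (_ : 2 * a * _ = a * t' k ^+ 2)//; field.
have lim2a : 2 * a <= (2 / alpha) * (0 - F'' h h - 2 * 0).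
  apply/ler_addgt0Pr => e e0.
  have /cvgrPdist_le/(_ _ e0)/filter_ex[k Hk] := upc.
  have := le_trans (quot_lo k) (quot_up k).
  by move: Hk; rewrite ler_norml => /andP[]; lra.
have [h0|h0] := eqVneq h 0.
  by move: lim2a; rewrite h0 F''00 !mulr0 !subr0 mulr0 pmulr_rle0// leNgt a_gt0.
have := ssc h h0; apply/negP; rewrite -leNgt.
have sub : (weak_star_subderivative2 calD (Pi co1 ubar) phibar h <=
    ((2 / alpha) * (- F'' h h))%:E)%E.
  apply: (@le_trans _ _ (limn_einf (fun k => (quot (u' k) (t' k) (h' k))%:E))).
    apply: ereal_inf_lbound; exists t', h'; split => //.
    by congr limn_einf; apply/funext => k; exact: esym (quotE (uE (n_ k)) (Dfin (n_ k))).
  have -> : 2 / alpha * - F'' h h = (2 / alpha) * (0 - F'' h h - 2 * 0) by ring.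
  by apply: limn_einf_le_cvg upc => k; rewrite lee_fin.
have a2' : (0%R <= (alpha / 2)%:E)%E by rewrite lee_fin ltW.
apply: (le_trans (leeD2l _ (lee_wpmul2l a2' sub))).
rewrite -EFinM -EFinD lee_fin.
by rewrite (_ : _ + _ = 0)//; field; rewrite gt_eqF.
Unshelve. all: by end_near. Qed.

End second_order.

Theorem theorem5p2 (R : realType) (d : nat)
  (omega0 omega1 : set 'rV[R]_d)
  (omega0_compact : compact omega0) (omega1_compact : compact omega1)
  (omega1_regular : omega1 = closure omega1°)
  (omega1_quasiconvex : uniformly_locally_quasiconvex omega1°)
  (c : 'rV[R]_d -> 'rV[R]_d -> R)
  (c_continuous : {within omega0 `*` omega1,
     continuous (fun z : 'rV[R]_d * 'rV[R]_d => c z.1 z.2)})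
  (u0 : {finite_measure set (borelRd R d) -> \bar R})
  (u0_concentrated : concentrated omega0 u0)
  (u0_mass : (0 < u0 omega0)%E)
  (u0_support : measure_support u0 = omega0)
  (ubar : signed_measure omega1)
  (ubar_ge0 : forall A, measurable A -> (0 <= ubar A)%E)
  (ubar_mass : ubar omega1 = u0 omega0)
  (alpha : R) (alpha_gt0 : 0 < alpha)
  (F : signed_measure omega1 -> R)
  (calF : C1_dual omega1 -> R)
  (calF_extends : forall u, calF (Pi omega1_compact u) = F u)
  (F' : C1 omega1)
  (F'' : C1_dual omega1 -> C1_dual omega1 -> R)
  (F''_bounded_bilinear : bounded_bilinear F'')
  (F_expansion : forall (t : nat -> R) (h_ : nat -> C1_dual omega1)
     (h : C1_dual omega1),
     (forall k, 0 < t k) -> t @ \oo --> 0 -> weak_star_cvg h_ h ->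
     (forall k, (dual_transport_cost omega0 c u0 omega1_compact
        (Pi omega1_compact ubar + t k *: h_ k)%R < +oo)%E) ->
     (calF (Pi omega1_compact ubar + t k *: h_ k)
        - calF (Pi omega1_compact ubar) - t k * h_ k F'
        - 2^-1 * t k ^+ 2 * F'' (h_ k) (h_ k)) / t k ^+ 2
       @[k --> \oo] --> 0)
  (F''_continuous : forall (h_ : nat -> C1_dual omega1) (h : C1_dual omega1),
     weak_star_cvg h_ h -> F'' (h_ k) (h_ k) @[k --> \oo] --> F'' h h)
  (phibar : C1 omega1) (phibarE : phibar = - (2 / alpha) *: F')
  (phibar_potential : kantorovich_potential omega0 c u0 ubar phibar)
  (Tbar : borelRd R d -> borelRd R d)
  (Tbar_measurable : measurable_fun (omega0 : set (borelRd R d)) Tbar)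
  (Tbar_range : forall x, omega0 x -> omega1 (Tbar x))
  (eps0 gamma C : R)
  (eps0_gt0 : 0 < eps0) (gamma_gt0 : 0 < gamma) (C_gt0 : 0 < C)
  (delta : 'rV[R]_d -> R)
  (delta_ge0 : forall x, omega0 x -> 0 <= delta x)
  (growth_near : forall x eta, omega0 x -> omega1 eta ->
     enorm (eta - Tbar x) <= eps0 ->
     c x eta - phibar eta >= c x (Tbar x) - phibar (Tbar x)
                             + gamma / 2 * enorm (eta - Tbar x) ^+ 2)
  (growth_far : forall x eta, omega0 x -> omega1 eta ->
     ~ (enorm (eta - Tbar x) <= eps0) ->
     c x eta - phibar eta >= c x (Tbar x) - phibar (Tbar x) + delta x)
  (delta_sublevel : forall kappa, 0 <= kappa ->
     measurable ([set x | omega0 x /\ delta x <= kappa]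
                   : set (borelRd R d)) /\
     (u0 [set x | omega0 x /\ (delta x <= kappa)%R] <= (C * kappa)%:E)%E) :
  (forall h : C1_dual omega1, h != 0 ->
     (0 < (F'' h h)%:E + (alpha / 2)%:E *
        weak_star_subderivative2
          (dual_transport_cost omega0 c u0 omega1_compact)
          (Pi omega1_compact ubar) phibar h)%E)
  <->
  (exists kappa eps : R, [/\ 0 < kappa, 0 < eps &
     forall u : signed_measure omega1,
       BL_norm omega1 (cadd u (copp ubar)) <= eps ->
       ((F u)%:E + (alpha / 2)%:E * transport_cost omega0 c u0 u >=
        (F ubar)%:E + (alpha / 2)%:E * transport_cost omega0 c u0 ubar
        + (kappa / 2 * BL_norm omega1 (cadd u (copp ubar)) ^+ 2)%:E)%E]).
Proof.
have D_ubar := transport_cost_ubar Tbar_range gamma_gt0 delta_ge0 growth_near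
  growth_far phibar_potential.
have [a a0 Da] := transport_quadratic_growth omega0_compact omega1_compact
  c_continuous u0_concentrated Tbar_measurable Tbar_range gamma_gt0 C_gt0
  delta_ge0 growth_near growth_far delta_sublevel phibar_potential.
have D_fin (u : signed_measure omega1) :=
  @transport_cost_fin _ _ _ _ omega0_compact omega1_compact _ c_continuous _
  u0_concentrated _ _ Tbar_measurable Tbar_range _ _ gamma_gt0 _ delta_ge0
  growth_near growth_far u.
have [K K0 lipK] := C1_lipschitz omega1_compact omega1_regular omega1_quasiconvex.
have Pi_le := Pi_le_BL_norm omega1_compact lipK.
have maxK : 0 <= Num.max 1 K by rewrite le_max ler01.
have F''00 : F'' 0 0 = 0.
  have [[_ lin] _] := F''_bounded_bilinear; have := lin 0 (-1) 0 0.
  by rewrite scaler0 addr0 /= mulN1r addNr.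
split => [ssc|[kappa [eps [kappa0 eps0' growth]]]].
  apply: (second_order_growth omega1_regular alpha_gt0 calF_extends F''00
    F_expansion F''_continuous phibarE D_ubar D_fin maxK Pi_le a0 _ ssc) => u r Du.
  exact: Da Du D_ubar.
exact: (growth_second_order omega0_compact u0_concentrated alpha_gt0
  calF_extends F_expansion F''_continuous phibarE D_ubar D_fin maxK Pi_le
  kappa0 eps0' growth).
Qed.
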